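(* Let $R$ be an $h$-local Prüfer domain and let $M$ be a completely decomposable torsion-free $R$-module (of arbitrary rank). Then every direct summand of $M$ is completely decomposable.
   Context: $R$ is a commutative integral domain with field of quotients $Q$. A domain $R$ is $h$-local if every non-zero element of $R$ belongs to only finitely many maximal ideals, and every non-zero prime ideal is contained in only a single maximal ideal. A torsion-free $R$-module has rank 1 if it is isomorphic to a non-zero submodule of $Q$. A torsion-free $R$-module is completely decomposable if it is a direct sum (of any number) of rank 1 submodules; the zero module is the empty direct sum. *)

(* Defs.v *)
From HB Require Import structures.
From mathcomp Require Import all_boot all_order all_algebra.
From mathcomp Require Import boolp classical_sets functions cardinality fsbigop.

Set Implicit Arguments.
Unset Strict Implicit.
Unset Printing Implicit Defensive.

Import GRing.Theory.
Local Open Scope classical_set_scope.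
Local Open Scope ring_scope.

(* The field of quotients Q of R as an R-module. An alias is used so that the
   scaling by R does not clash with other module structures on {fraction R}. *)
Definition quotfield (R : idomainType) : Type := {fraction R}.

Section QuotientFieldModule.
Variable R : idomainType.

HB.instance Definition _ := GRing.Field.on (quotfield R).

Definition toquot : R -> quotfield R := @tofrac R.

HB.instance Definition _ := GRing.RMorphism.copy toquot (@tofrac R).

Definition quotfield_scale (r : R) (x : quotfield R) : quotfield R :=
  toquot r * x.

Fact quotfield_scaleA a b v :
  quotfield_scale a (quotfield_scale b v) = quotfield_scale (a * b) v.
Proof. by rewrite /quotfield_scale mulrA rmorphM. Qed.

Fact quotfield_scale1 : left_id 1 quotfield_scale.
Proof. by move=> v; rewrite /quotfield_scale rmorph1 mul1r. Qed.

Fact quotfield_scaleDr : right_distributive quotfield_scale +%R.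
Proof. by move=> a u v; rewrite /quotfield_scale mulrDr. Qed.

Fact quotfield_scaleDl v : {morph quotfield_scale^~ v : a b / a + b}.
Proof. by move=> a b; rewrite /quotfield_scale rmorphD mulrDl. Qed.

HB.instance Definition _ := GRing.Zmodule_isLmodule.Build R (quotfield R)
  quotfield_scaleA quotfield_scale1 quotfield_scaleDr quotfield_scaleDl.

End QuotientFieldModule.

(** Ideals and domains *)

(* idealr_closed already demands that 1 is not in the ideal. *)
Definition maximal_ideal (R : idomainType) (m : set R) : Prop :=
  idealr_closed [in m] /\
  forall J : set R, idealr_closed [in J] -> m `<=` J -> J = m.

Definition prime_ideal (R : idomainType) (P : set R) : Prop :=
  idealr_closed [in P] /\ prime_idealr_closed [in P].

Definition h_local (R : idomainType) : Prop :=
  (forall r : R, r != 0 ->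
     finite_set [set m : set R | maximal_ideal m /\ m r]) /\
  (forall P : set R, prime_ideal P -> P <> [set 0] ->
     exists! m : set R, maximal_ideal m /\ P `<=` m).

Definition ideal_gen (R : idomainType) (s : seq R) : set R :=
  [set x | exists c : nat -> R, x = \sum_(i < size s) c i * s`_i].

Definition submodule (R : idomainType) (M : lmodType R) (A : set M) : Prop :=
  submod_closed [in A].

Definition frac_mul (R : idomainType) (A B : set (quotfield R)) :
    set (quotfield R) :=
  [set x | exists s : seq (quotfield R * quotfield R),
     (forall p, p \in s -> A p.1 /\ B p.2) /\ x = \sum_(p <- s) p.1 * p.2].

Definition invertible (R : idomainType) (A : set (quotfield R)) : Prop :=
  exists B : set (quotfield R),
    submodule B /\ frac_mul A B = range (@toquot R).

(* Every non-zero finitely generated ideal is invertible. *)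
Definition prufer (R : idomainType) : Prop :=
  forall s : seq R, ideal_gen s <> [set 0] ->
    invertible (@toquot R @` ideal_gen s).

(** Modules: the notions are stated for submodules of an ambient module M;
    M itself is [set: M]. *)

Definition torsion_free (R : idomainType) (M : lmodType R) (A : set M) : Prop :=
  forall (r : R) (x : M), A x -> r *: x = 0 -> r = 0 \/ x = 0.

Definition submodule_iso (R : idomainType) (U V : lmodType R)
    (A : set U) (B : set V) : Prop :=
  exists f : U -> V,
    (forall (r : R) (x y : U), A x -> A y -> f (r *: x + y) = r *: f x + f y)
    /\ set_bij A B f.

Definition rank_one (R : idomainType) (M : lmodType R) (A : set M) : Prop :=
  [/\ submodule A, torsion_free A
    & exists J : set (quotfield R),
        [/\ submodule J, J <> [set 0] & submodule_iso A J]].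

(* The submodule A is the internal direct sum of the family L: each element is
   uniquely the sum of a finitely supported choice of elements of the L i. *)
Definition is_direct_sum (R : idomainType) (M : lmodType R) (I : choiceType)
    (L : I -> set M) (A : set M) : Prop :=
  (forall i, L i `<=` A) /\
  forall x, A x -> exists! g : I -> M,
    [/\ forall i, L i (g i), finite_set [set i | g i <> 0]
      & x = \sum_(i \in [set: I]) g i].

Definition completely_decomposable (R : idomainType) (M : lmodType R)
    (A : set M) : Prop :=
  [/\ submodule A, torsion_free A
    & exists (I : choiceType) (L : I -> set M),
        (forall i, rank_one (L i)) /\ is_direct_sum L A].

Definition direct_summand (R : idomainType) (M : lmodType R) (A : set M) :
    Prop :=
  submodule A /\
  exists B : set M,
    [/\ submodule B, A `&` B = [set 0]
      & forall x : M, exists a b : M, [/\ A a, B b & x = a + b]].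

(* Main.v *)
(* Identify M with a direct sum of submodules J i of Q, preordered by i <= j iff
   q J i is contained in J j for some nonzero q in Q, and let e be an idempotent
   endomorphism of M with image N.  A nonzero map from J i to J j forces i <= j,
   so e preserves the partial sums over up-closed sets of indices.

   If x in M is supported in a single class of the preorder, its pure hull is a
   summand of M: after rescaling, x = (1, ..., 1) in J_1 + ... + J_n with the J_i
   quasi-equal, and one needs rho_i in [J_1 /\ ... /\ J_n : J_i] with sum 1.  These
   exist because the ideal of attainable sums lies in no maximal ideal m: the
   localizations of the J_i at m form a chain, and h-locality turns the inclusions
   of the smallest one into global ones by a multiplier outside m.

   Induction on the support then puts every x in N into a finite rank completely
   decomposable summand of N.  So N is completely decomposable if it has countable
   rank, and Kaplansky's argument, gluing e-invariant partial sums M_A along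
   countable extensions of A, gives the general case. *)

Require Import Defs.
From mathcomp Require Import all_boot all_order all_algebra.
From mathcomp Require Import boolp classical_sets functions cardinality fsbigop.
From mathcomp Require Import ring.

Set Implicit Arguments.
Unset Strict Implicit.
Unset Printing Implicit Defensive.

Import GRing.Theory.
Local Open Scope classical_set_scope.
Local Open Scope ring_scope.

(** * Ideals, maximal ideals, and separation of maximal ideals in an h-local domain *)

Section Ideals.
Variable R : idomainType.
Implicit Types (A S m : set R).

Definition ideal A : Prop :=
  A 0 /\ forall a u v : R, A u -> A v -> A (a * u + v).

Lemma idealMl A a u : ideal A -> A u -> A (a * u).
Proof. by case=> A0 AD Au; rewrite -[a * u]addr0; apply: AD. Qed.

Lemma idealr_closedE A : idealr_closed [in A] <-> ideal A /\ ~ A 1.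
Proof.
split=> [[A0 A1 AD]|[[A0 AD] A1]]; split.
- split=> [|a u v Au Av]; first exact: set_mem.
  by apply/set_mem/AD; apply/mem_set.
- by move=> A1'; move: A1; rewrite [in X in X -> _]/= mem_set.
- exact: mem_set.
- by apply/negP => /set_mem.
- by move=> a u v /set_mem Au /set_mem Av; apply/mem_set/AD.
Qed.

Lemma ideal_avoiding A S : ideal A -> A `&` S = set0 ->
  exists m, [/\ ideal m, A `<=` m, m `&` S = set0 &
    forall J, ideal J -> m `<=` J -> J `&` S = set0 -> J = m].
Proof.
move=> Aid AS; pose good X := [/\ ideal X, A `<=` X & X `&` S = set0].
have [F Ftot FP|m [mP mmax]] := @Zorn_bigcup R [set X | X = set0 \/ good X].
  have [[X1 [FX1 gX1]]|nog] := pselect (exists X, F X /\ good X); last first.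
    left; rewrite -subset0 => x [X FX Xx].
    by have [X0|gX] := Ftot _ FX; [rewrite X0 in Xx | case: nog; exists X].
  have memg X x : F X -> X x -> good X.
    by move=> FX Xx; have [X0|//] := Ftot _ FX; rewrite X0 in Xx.
  right; have [[X10 _] AX1 _] := gX1; split.
  - split=> [|a u v [X FX Xu] [Y FY Yv]]; first by exists X1.
    have [[_ XD] _ _] := memg _ _ FX Xu; have [[_ YD] _ _] := memg _ _ FY Yv.
    have [XY|YX] := FP _ _ FX FY; first by exists Y => //; apply: YD => //; apply: XY.
    by exists X => //; apply: XD => //; apply: YX.
  - by move=> x Ax; exists X1 => //; apply: AX1.
  - rewrite -subset0 => x [[X FX Xx] Sx].
    by have [_ _ XS] := memg _ _ FX Xx; rewrite -XS.
have gm : good m.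
  case: mP => // m0; exfalso; apply: (mmax A); last by right; split.
  by rewrite m0; split=> // /(_ 0); apply; case: Aid.
have [idm Am mS] := gm; exists m; split=> // J Jid mJ JS.
apply: contrapT => JNm; apply: (mmax J); last first.
  by right; split=> //; apply: subset_trans Am mJ.
by split=> // Jm; apply: JNm; rewrite eqEsubset.
Qed.

Lemma maximal_idealP m : maximal_ideal m ->
  [/\ ideal m, ~ m 1 & forall x, ~ m x -> exists2 y, m y & exists a, y + a * x = 1].
Proof.
case=> /idealr_closedE[idm m1] mmax; split=> // x mx; have [m0 mD] := idm.
apply: contrapT => no1; apply: mx.
pose J := [set z | exists2 y, m y & exists a, z = y + a * x].
have <- : J = m.
  apply: mmax; last by move=> y my; exists y => //; exists 0; rewrite mul0r addr0.
  apply/idealr_closedE; split; last first.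
    by case=> y my [a ya]; apply: no1; exists y => //; exists a.
  split; first by exists 0 => //; exists 0; rewrite mul0r addr0.
  move=> b _ _ [y my [a ->]] [y' my' [a' ->]]; exists (b * y + y').
    exact: mD.
  by exists (b * a + a'); ring.
by exists 0 => //; exists 1; rewrite mul1r add0r.
Qed.

Lemma maximal_ideal_mul m x y : maximal_ideal m -> ~ m x -> ~ m y -> ~ m (x * y).
Proof.
move=> /maximal_idealP[idm m1 mP] /mP[u mu [a ua]] /mP[v mv [b vb]] mxy; apply: m1.
(* This is the product [(u + a * x) * (v + b * y) = 1] expanded; every summand lies in [m]. *)
have -> : 1 = (a * b) * (x * y) + ((v + b * y) * u + (a * x) * v).
  by rewrite -{1}[1]mul1r -{1}ua -vb; ring.
have mMl c w : m w -> m (c * w) by exact: idealMl.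
by have [_ mD] := idm; apply: (mD) => //; apply: mD => //; apply: mMl.
Qed.

Lemma ideal_in_maximal A : ideal A -> ~ A 1 ->
  exists m, maximal_ideal m /\ A `<=` m.
Proof.
move=> Aid A1; have [|m [idm Am m1 mmax]] := @ideal_avoiding A [set 1] Aid.
  by rewrite -subset0 => x [Ax x1]; rewrite /= x1 in Ax.
have no1 J : J `&` [set 1] = set0 <-> ~ J 1.
  rewrite -subset0; split=> [JS J1|J1 x [Jx x1]]; first exact: (JS 1).
  by rewrite /= x1 in Jx.
exists m; split=> //; split; first by apply/idealr_closedE; split=> //; apply/no1.
by move=> J /idealr_closedE[idJ J1] mJ; apply: mmax => //; apply/no1.
Qed.

(** If no such pair existed, the products [u * s] would form a multiplicative set [S] missing the
    ideal [a R]. An ideal maximal among those containing [a] and avoiding [S] is prime and nonzero,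
    and lies in both [m] and [m'], against h-locality. *)
Lemma h_local_separation (a : R) m m' : h_local R -> a != 0 ->
  maximal_ideal m -> maximal_ideal m' -> m <> m' ->
  exists s u, [/\ ~ m s, ~ m' u & exists b, u * s = b * a].
Proof.
move=> [_ hl] a0 maxm maxm' mm'.
apply: contrapT => none.
pose S := [set x | exists s u, [/\ ~ m s, ~ m' u & x = u * s]].
have [idm m1 _] := maximal_idealP maxm; have [idm' m1' _] := maximal_idealP maxm'.
pose A := [set x | exists b, x = b * a].
have idA : ideal A.
  split=> [|c _ _ [b ->] [b' ->]]; first by exists 0; rewrite mul0r.
  by exists (c * b + b'); ring.
have [|P [idP AP PS Pmax]] := @ideal_avoiding A S idA.
  rewrite -subset0 => x [[b xb] [s [u [ms mu xus]]]]; apply: none.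
  by exists s, u; split=> //; exists b; rewrite -xus.
have PSx x : P x -> ~ S x by move=> Px Sx; have : (P `&` S) x by []; rewrite PS.
have S1 : S 1 by exists 1, 1; split=> //; rewrite mulr1.
have SM x y : S x -> S y -> S (x * y).
  move=> [s [u [ms mu ->]]] [s' [u' [ms' mu' ->]]]; exists (s * s'), (u * u').
  split; [exact: maximal_ideal_mul | exact: maximal_ideal_mul | by ring].
have P0 : P 0 by case: idP.
have PMl c w : P w -> P (c * w) by exact: idealMl.
have PD u v : P u -> P v -> P (u + v).
  by move=> Pu Pv; rewrite -[u]mul1r; case: idP => _; apply.
have meetS x : ~ P x -> exists2 p, P p & exists c, S (p + c * x).
  move=> Px; apply: contrapT => nS; apply: Px.
  pose J := [set z | exists2 p, P p & exists c, z = p + c * x].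
  have <- : J = P.
    apply: Pmax; last first.
    - rewrite -subset0 => z [[p Pp [c ->]] Sz]; apply: nS.
      by exists p => //; exists c.
    - by move=> p Pp; exists p => //; exists 0; rewrite mul0r addr0.
    split; first by exists 0 => //; exists 0; rewrite mul0r addr0.
    move=> d _ _ [p Pp [c ->]] [p' Pp' [c' ->]]; exists (d * p + p').
      by apply: PD => //; apply: PMl.
    by exists (d * c + c'); ring.
  by exists 0 => //; exists 1; rewrite mul1r add0r.
have primeP : prime_ideal P.
  split; first by apply/idealr_closedE; split=> // /PSx; apply.
  move=> x y /set_mem Pxy; apply/orP.
  have [Px|/meetS[p Pp [c Sx]]] := pselect (P x); first by left; apply: mem_set.
  have [Py|/meetS[q Pq [d Sy]]] := pselect (P y); first by right; apply: mem_set.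
  exfalso; apply: (PSx _ _ (SM _ _ Sx Sy)).
  have -> : (p + c * x) * (q + d * y) = (q + d * y) * p + ((c * x) * q + (c * d) * (x * y)).
    by ring.
  by apply: (PD); [exact: PMl | apply: PD; exact: PMl].
have PN0 : P <> [set 0].
  move=> P0'; have : P a by apply: AP; exists 1; rewrite mul1r.
  by rewrite P0' /=; apply/eqP.
have [m0 [_ uniq]] := hl P primeP PN0; apply: mm'.
rewrite -(uniq m) ?(uniq m') //; split=> // x Px; apply: contrapT => mx.
  by apply: (PSx _ Px); exists 1, x; split=> //; rewrite mulr1.
by apply: (PSx _ Px); exists x, 1; split=> //; rewrite mul1r.
Qed.

End Ideals.

(** Individual multipliers are multiplied together. [D] will be the nonzero elements or the
    complement of a maximal ideal. *)
Lemma common_multiplier (R : idomainType) (X : eqType) (D : R -> Prop)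
    (P : X -> R -> Prop) (s : seq X) :
  D 1 -> (forall r t, D r -> D t -> D (r * t)) ->
  (forall x r t, P x r -> P x (t * r)) ->
  (forall x, x \in s -> exists2 r, D r & P x r) ->
  exists2 r, D r & forall x, x \in s -> P x r.
Proof.
move=> D1 DM PM; elim: s => [|x s IHs] Ps; first by exists 1.
have [r Dr Pr] := Ps x (mem_head _ _).
have [|t Dt Pt] := IHs; first by move=> y ys; apply: Ps; rewrite inE ys orbT.
exists (r * t); first exact: DM.
by move=> y; rewrite inE => /orP[/eqP->|/Pt Pty]; [rewrite mulrC|]; apply: PM.
Qed.

(** * Fractions, and the valuation property of a Prüfer domain at a maximal ideal *)

Section Fractional.
Variable R : idomainType.
Local Notation Q := (quotfield R).
Local Notation "r %:K" := (toquot r) (at level 1, format "r %:K").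

Lemma scale_quotE (r : R) (q : Q) : r *: q = r%:K * q. Proof. by []. Qed.

Lemma toquotM : {morph @toquot R : a b / a * b}. Proof. exact: rmorphM. Qed.

Lemma toquotD : {morph @toquot R : a b / a + b}. Proof. exact: rmorphD. Qed.

Lemma toquot1 : (1 : R)%:K = 1. Proof. exact: rmorph1. Qed.

Lemma toquot_inj : injective (@toquot R).
Proof. by move=> x y /eqP; rewrite /toquot tofrac_eq => /eqP. Qed.

Lemma toquot_eq0 (r : R) : (r%:K == 0) = (r == 0).
Proof. exact: tofrac_eq0. Qed.

Lemma quotfieldP (q : Q) : exists r d : R, d != 0 /\ d%:K * q = r%:K.
Proof.
elim/quotW: q => x; exists \n_x, \d_x; split; first exact: denom_ratioP.
rewrite /toquot; unlock FracField.tofrac.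
rewrite -[LHS]FracField.pi_mul; apply/eqP; rewrite FracField.equivf_def /FracField.mulf.
by rewrite !numden_Ratio ?mulf_neq0 ?oner_neq0 ?denom_ratioP // mul1r mulr1 mulrC.
Qed.

Lemma submoduleE (M : lmodType R) (A : set M) :
  submodule A <-> A 0 /\ forall (r : R) u v, A u -> A v -> A (r *: u + v).
Proof.
split=> [[A0 AD]|[A0 AD]]; split=> [|r u v].
- exact: set_mem.
- by move=> Au Av; apply/set_mem/AD; apply/mem_set.
- exact: mem_set.
- by move=> /set_mem Au /set_mem Av; apply/mem_set/AD.
Qed.

Lemma submoduleZ (M : lmodType R) (A : set M) (r : R) u : submodule A -> A u -> A (r *: u).
Proof. by move=> /submoduleE[A0 AD] Au; rewrite -[_ *: _]addr0; apply: AD. Qed.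

Lemma submoduleD (M : lmodType R) (A : set M) u v : submodule A -> A u -> A v -> A (u + v).
Proof. by move=> /submoduleE[A0 AD] Au Av; rewrite -[u]scale1r; apply: AD. Qed.

(** Invertibility of the ideal generated by [a] and [b] gives [1 = a p + b q] where [a p], [b p],
    [a q], [b q] all lie in [R]. One of [a p], [b q] is outside [m] and serves as [r], by
    [(a p) b = (b p) a] and [(b q) a = (a q) b]. *)
Lemma prufer_fractions (m : set R) (a b : R) : prufer R -> maximal_ideal m ->
  exists2 r, ~ m r & (exists c, r * a = c * b) \/ (exists c, r * b = c * a).
Proof.
move=> pr maxm; have [idm m1 _] := maximal_idealP maxm.
have [[a0 b0]|ab] := pselect (a = 0 /\ b = 0).
  by exists 1 => //; left; exists 0; rewrite a0 b0 !mulr0.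
have genP x : ideal_gen [:: a; b] x <-> exists c d, x = c * a + d * b.
  split=> [[c ->]|[c [d ->]]].
    by exists (c 0), (c 1); rewrite !big_ord_recl big_ord0 addr0.
  by exists (fun i => if i == 0%N then c else d); rewrite !big_ord_recl big_ord0 addr0.
have gena : ideal_gen [:: a; b] a by apply/genP; exists 1, 0; ring.
have genb : ideal_gen [:: a; b] b by apply/genP; exists 0, 1; ring.
have gen0 : ideal_gen [:: a; b] <> [set 0].
  by move=> g0; apply: ab; move: gena genb; rewrite g0.
have [B [Bsub AB]] := pr _ gen0; have [B0 BD] := (submoduleE B).1 Bsub.
have mulB c q : ideal_gen [:: a; b] c -> B q -> exists r, c%:K * q = r%:K.
  move=> gc Bq; have : range (@toquot R) (c%:K * q); last by case=> r _ <-; exists r.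
  rewrite -AB; exists [:: (c%:K, q)]; split; last by rewrite big_seq1.
  by move=> p; rewrite inE => /eqP->; split=> //; exists c.
have [p [q [Bp Bq pq]]] : exists p q, [/\ B p, B q & 1 = a%:K * p + b%:K * q].
  have : range (@toquot R) 1 by exists 1 => //; rewrite toquot1.
  rewrite -AB => -[s [sAB ->]]; elim: s sAB => [|x s IHs] sAB.
    by exists 0, 0; rewrite big_nil !mulr0 addr0.
  have [|p [q [Bp Bq pq]]] := IHs.
    by move=> y ys; apply: sAB; rewrite inE ys orbT.
  have [[_ /genP[c [d ->]] zx] Bx] := sAB x (mem_head _ _).
  exists (c *: x.2 + p), (d *: x.2 + q); rewrite big_cons -zx pq !scale_quotE.
  by split; [exact: BD | exact: BD | rewrite toquotD !toquotM; ring].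
have [r1 ap] := mulB _ _ gena Bp; have [r2 bp] := mulB _ _ genb Bp.
have [r3 aq] := mulB _ _ gena Bq; have [r4 bq] := mulB _ _ genb Bq.
have [mr1|mr1] := pselect (m r1); last first.
  exists r1 => //; right; exists r2; apply: toquot_inj.
  by rewrite !toquotM -ap -bp; ring.
exists r4; last first.
  by left; exists r3; apply: toquot_inj; rewrite !toquotM -aq -bq; ring.
move=> mr4; apply: m1; have -> : 1 = r1 + r4.
  by apply: toquot_inj; rewrite toquot1 toquotD pq ap bq.
by rewrite -[r1]mul1r; case: idm => _; apply.
Qed.

(* The localization of [R] at [m] is a valuation ring. *)
Lemma prufer_valuation (m : set R) (y z : Q) : prufer R -> maximal_ideal m ->
  exists2 r, ~ m r & (exists c, r%:K * y = c%:K * z) \/ (exists c, r%:K * z = c%:K * y).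
Proof.
move=> pr maxm; have [a [d [d0 ya]]] := quotfieldP y.
have [b [d' [d'0 zb]]] := quotfieldP z.
have dd' : (d * d')%:K != 0 by rewrite toquot_eq0 mulf_neq0.
have [r mr rab] := prufer_fractions (d' * a) (d * b) pr maxm.
exists r => //; case: rab => -[c rc]; [left|right]; exists c; apply: (mulfI dd').
  have := congr1 (@toquot R) rc; rewrite !toquotM -ya -zb => e.
  by transitivity (r%:K * (d'%:K * (d%:K * y))); [ring | rewrite e; ring].
have := congr1 (@toquot R) rc; rewrite !toquotM -ya -zb => e.
by transitivity (r%:K * (d%:K * (d'%:K * z))); [ring | rewrite e; ring].
Qed.

End Fractional.

(** * Local comparison of fractional modules and partitions of unity *)

Section PartitionOfUnity.
Variable R : idomainType.
Local Notation Q := (quotfield R).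
Local Notation "r %:K" := (toquot r) (at level 1, format "r %:K").
Implicit Types (A B C : set Q) (m : set R).

(* [A] is contained in the localization of [B] at [m]. *)
Definition local_sub m A B : Prop := forall y, A y -> exists2 r, ~ m r & B (r *: y).

Lemma local_sub_trans m A B C : maximal_ideal m ->
  local_sub m A B -> local_sub m B C -> local_sub m A C.
Proof.
move=> maxm AB BC y /AB[r mr /BC[t mt Cy]]; exists (t * r); last by rewrite -scalerA.
exact: maximal_ideal_mul.
Qed.

(** If some [y] in [A] has no multiple in [B] by an element outside [m], the valuation property
    makes every [z] in [B] locally a multiple of [y]. *)
Lemma local_sub_total m A B : prufer R -> maximal_ideal m ->
  submodule A -> submodule B -> local_sub m A B \/ local_sub m B A.
Proof.
move=> pr maxm subA subB; have [|nAB] := pselect (local_sub m A B); first by left.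
right=> z Bz; have [y [Ay nBy]] : exists y, A y /\ forall r, ~ m r -> ~ B (r *: y).
  apply: contrapT => none; apply: nAB => y Ay; apply: contrapT => nr; apply: none.
  by exists y; split=> // r mr By; apply: nr; exists r.
have [r mr [[c e]|[c e]]] := prufer_valuation y z pr maxm.
  case: (nBy r mr); rewrite scale_quotE e -scale_quotE; exact: submoduleZ.
by exists r => //; rewrite scale_quotE e -scale_quotE; apply: submoduleZ.
Qed.

Lemma local_sub_min m (I : eqType) (J : I -> set Q) (s : seq I) :
  prufer R -> maximal_ideal m -> (forall i, submodule (J i)) -> s != [::] ->
  exists2 i, i \in s & forall j, j \in s -> local_sub m (J i) (J j).
Proof.
move=> pr maxm subJ.
have refl A : local_sub m A A.
  by move=> y Ay; have [_ m1 _] := maximal_idealP maxm; exists 1; rewrite ?scale1r.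
elim: s => [//|k s IHs] _; have [->|/IHs[i si imin]] := eqVneq s [::].
  by exists k; rewrite ?mem_seq1 // => j; rewrite mem_seq1 => /eqP->.
have [ik|ki] := local_sub_total pr maxm (subJ i) (subJ k).
  by exists i => [|j]; rewrite inE ?si ?orbT // => /orP[/eqP->|/imin].
exists k => [|j]; rewrite inE ?eqxx // => /orP[/eqP->|/imin]; first exact: refl.
exact: local_sub_trans.
Qed.

(** The modules are quasi-equal with the single multiplier [a], so only the finitely many maximal
    ideals containing [a] can obstruct an inclusion. This is why a local inclusion at [m] can be
    made global by one multiplier outside [m]. *)
Lemma partition_of_unity (I : eqType) (J : I -> set Q) (s : seq I) (a : R) :
  h_local R -> prufer R -> (forall i, submodule (J i)) ->
  uniq s -> s != [::] -> a != 0 ->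
  (forall i j z, i \in s -> j \in s -> J i z -> J j (a *: z)) ->
  exists2 rho : I -> Q, \sum_(i <- s) rho i = 1 &
    forall i j z, i \in s -> j \in s -> J i z -> J j (rho i * z).
Proof.
move=> hl pr subJ us s0 a0 Ja.
pose C := [set r : R | exists2 rho : I -> Q, \sum_(i <- s) rho i = r%:K &
    forall i j z, i \in s -> j \in s -> J i z -> J j (rho i * z)].
suff : C 1 by rewrite /C /= toquot1.
have idC : ideal C.
  split=> [|r u v [f fu fJ] [g gv gJ]].
    exists (fun=> 0); first by rewrite big1 // /toquot rmorph0.
    by move=> i j z _ _ _; rewrite mul0r; have [] := (submoduleE _).1 (subJ j).
  exists (fun i => r%:K * f i + g i).
    by rewrite big_split -mulr_sumr /= fu gv toquotD toquotM.
  move=> i j z si sj Jz; rewrite mulrDl -mulrA -scale_quotE.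
  have [_ JD] := (submoduleE _).1 (subJ j).
  by apply: JD; [apply: (fJ i) | apply: (gJ i)].
apply: contrapT => /(ideal_in_maximal idC)[m [maxm Cm]].
have [_ m1 _] := maximal_idealP maxm.
have [i si imin] := local_sub_min pr maxm subJ s0.
have [ms msE] := (finite_seqP _).1 (hl.1 a a0).
have memms m' : m' \in ms <-> maximal_ideal m' /\ m' a.
  by have := congr1 (@^~ m') msE; rewrite /= => ->.
(* [t] is outside [m] but locally divisible by [a] at every other maximal ideal containing [a]; it
   is a product of finitely many separating elements. *)
have [t mt tP] : exists2 t, ~ m t & forall m', m' \in ms -> m' <> m ->
    exists2 u, ~ m' u & exists b, u * t = b * a.
  pose P (m' : set R) (t : R) :=
    m' <> m -> exists2 u, ~ m' u & exists b, u * t = b * a.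
  apply: (@common_multiplier _ _ (fun t => ~ m t) P) => //.
  - by move=> r t; apply: maximal_ideal_mul.
  - move=> m' r t Pr /Pr[u mu [b ub]]; exists u => //; exists (t * b).
    by rewrite mulrCA ub mulrA.
  - move=> m' /memms[maxm' _]; have [->|m'm] := pselect (m' = m).
      by exists 1 => // /(_ erefl).
    have mm' : m <> m' by move=> e; apply: m'm.
    have [t [u [mt m'u ut]]] := h_local_separation hl a0 maxm maxm' mm'.
    by exists t => // _; exists u.
(* All the weight [t] is put on the locally smallest module [J i]. *)
apply: mt; apply: Cm; exists (fun k => if k == i then t%:K else 0).
  rewrite (bigD1_seq i) //= eqxx big1 ?addr0 // => k /negPf->; by [].
move=> k j z sk sj; case: eqP => [->|_ _]; last first.
  by rewrite mul0r; have [] := (submoduleE _).1 (subJ j).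
move=> Jz; rewrite -scale_quotE.
(* The ideal [B] lies in no maximal ideal [m']: if [a] is outside [m'], then [a] itself is a
   witness; at [m] the minimality of [J i] gives one; at the remaining [m'] the choice of [t]
   does. *)
pose B := [set r : R | J j (r *: (t *: z))].
have idB : ideal B.
  have [J0 JD] := (submoduleE _).1 (subJ j).
  split=> [|r u v Bu Bv]; first by rewrite /B /= scale0r.
  by rewrite /B /= scalerDl -scalerA; apply: JD.
suff : B 1 by rewrite /B /= scale1r.
apply: contrapT => /(ideal_in_maximal idB)[m' [maxm' Bm']].
have [m'a|m'a] := pselect (m' a); last first.
  by apply: m'a; apply: Bm'; apply: (Ja i) => //; apply: submoduleZ.
have [mm'|m'm] := pselect (m' = m).
  have [r mr rz] := imin j sj z Jz; apply: mr; rewrite -mm'; apply: Bm'.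
  by rewrite /B /= scalerA mulrC -scalerA; apply: submoduleZ.
have [|u m'u [b ut]] := tP m' _ m'm; first exact/memms.
apply: m'u; apply: Bm'; rewrite /B /= scalerA ut -scalerA.
by apply: submoduleZ => //; apply: (Ja i).
Qed.

End PartitionOfUnity.

(** * Pure submodules and direct sums of pure hulls of single elements *)

Section Bases.
Variables (R : idomainType) (M : lmodType R).
Hypothesis tfM : forall (r : R) (x : M), r *: x = 0 -> r = 0 \/ x = 0.
Implicit Types (f g : M -> M) (K Z : set M).

Lemma scaler_regular (r : R) (x y : M) : r != 0 -> r *: x = r *: y -> x = y.
Proof.
move=> r0 /eqP; rewrite -subr_eq0 -scalerBr => /eqP /tfM[/eqP|].
  by rewrite (negPf r0).
by move=> /eqP; rewrite subr_eq0 => /eqP.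
Qed.

Lemma linear_map0 f : linear f -> f 0 = 0.
Proof. by move=> fl; have := fl (-1) 0 0; rewrite scaler0 addr0 scaleN1r addNr. Qed.

Lemma linear_mapZ f r u : linear f -> f (r *: u) = r *: f u.
Proof. by move=> fl; have := fl r u 0; rewrite (linear_map0 fl) !addr0. Qed.

Lemma linear_mapD f u v : linear f -> f (u + v) = f u + f v.
Proof. by move=> fl; have := fl 1 u v; rewrite !scale1r. Qed.

Lemma linear_mapB f u v : linear f -> f (u - v) = f u - f v.
Proof.
by move=> fl; rewrite -scaleN1r addrC fl scaleN1r addrC.
Qed.

Lemma linear_comp f g : linear f -> linear g -> linear (f \o g).
Proof. by move=> fl gl r u v /=; rewrite gl fl. Qed.

Definition pure K : Prop :=
  [/\ K 0, forall r u v, K u -> K v -> K (r *: u + v)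
    & forall (r : R) v, r != 0 -> K (r *: v) -> K v].

Lemma pureD K u v : pure K -> K u -> K v -> K (u + v).
Proof. by case=> _ KD _ Ku Kv; rewrite -[u]scale1r; apply: KD. Qed.

Lemma pureZ K r u : pure K -> K u -> K (r *: u).
Proof. by case=> K0 KD _ Ku; rewrite -[_ *: _]addr0; apply: KD. Qed.

Lemma pureB K u v : pure K -> K u -> K v -> K (u - v).
Proof. by move=> pK Ku Kv; rewrite -scaleN1r; apply: pureD => //; apply: pureZ. Qed.

Lemma pureI K K' : pure K -> pure K' -> pure (K `&` K').
Proof.
move=> [K0 KD KS] [K'0 K'D K'S]; split=> [//|r u v [Ku K'u] [Kv K'v]|r v r0 [Kv K'v]].
  by split; [apply: KD | apply: K'D].
by split; [apply: (KS r) | apply: (K'S r)].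
Qed.

Lemma pure_preim f K : linear f -> pure K -> pure [set v | K (f v)].
Proof.
move=> fl [K0 KD KS]; split=> [|r u v Ku Kv|r v r0]; rewrite /= ?(linear_map0 fl) ?fl //.
  exact: KD.
by rewrite (linear_mapZ _ _ fl) => /(KS _ _ r0).
Qed.

Lemma pure_eq f g : linear f -> linear g -> pure [set v | f v = g v].
Proof.
move=> fl gl; split=> [|r u v /= fu fv|r v r0]; rewrite /= ?(linear_map0 fl) ?(linear_map0 gl) ?fl ?gl ?fu ?fv //.
by rewrite (linear_mapZ _ _ fl) (linear_mapZ _ _ gl) => /(scaler_regular r0).
Qed.

(** This is the least pure submodule containing [z]: the elements of [M] on the line [Q z]. *)
Definition hull (z : M) : set M :=
  [set w | exists r s : R, r != 0 /\ r *: w = s *: z].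

Lemma hull_pure z : pure (hull z).
Proof.
split=> [|a u v [r [s [r0 ru]]] [r' [s' [r'0 rv]]]|t v t0 [r [s [r0 rv]]]].
- by exists 1, 0; rewrite oner_neq0 scaler0 scale0r.
- exists (r * r'), (a * r' * s + r * s'); split; first exact: mulf_neq0.
  rewrite scalerDr scalerDl -!scalerA -rv -ru !scalerA.
  by congr (_ *: _ + _ *: _); ring.
- by exists (r * t), s; rewrite mulf_neq0 // -scalerA.
Qed.

Lemma hull_id z : hull z z.
Proof. by exists 1, 1; rewrite oner_neq0. Qed.

Lemma hull_map f z w : linear f -> hull z w -> hull (f z) (f w).
Proof.
by move=> fl [r [s [r0 rw]]]; exists r, s; rewrite -!(linear_mapZ _ _ fl) rw.
Qed.

Lemma hull_sub K z : pure K -> K z -> hull z `<=` K.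
Proof.
move=> pK Kz w [r [s [r0 rw]]]; have [_ _ KS] := pK.
by apply: (KS r) => //; rewrite rw; apply: pureZ.
Qed.

(** The inductive form lets sums be handled by induction, with no index type and no finite
    supports. *)
Inductive hull_sum Z : M -> Prop :=
| HullSum0 : hull_sum Z 0
| HullSumD z w v : Z z -> hull z w -> hull_sum Z v -> hull_sum Z (w + v).

Lemma hull_sum_add Z u v : hull_sum Z u -> hull_sum Z v -> hull_sum Z (u + v).
Proof.
move=> + Zv; elim=> [|z w u' Zz zw _ IH]; first by rewrite add0r.
by rewrite -addrA; apply: HullSumD Zz zw IH.
Qed.

Lemma hull_sum_hull Z z w : Z z -> hull z w -> hull_sum Z w.
Proof. by move=> Zz zw; rewrite -[w]addr0; apply: HullSumD Zz zw (HullSum0 _). Qed.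

Lemma hull_sumS Z Z' : Z `<=` Z' -> hull_sum Z `<=` hull_sum Z'.
Proof.
move=> ZZ' v; elim=> [|z w u Zz zw _ IH]; first exact: HullSum0.
by apply: HullSumD (ZZ' _ Zz) zw IH.
Qed.

Lemma hull_sumU Z Z' v : hull_sum (Z `|` Z') v ->
  exists u u', [/\ hull_sum Z u, hull_sum Z' u' & v = u + u'].
Proof.
elim=> [|z w u Zz zw _ [a [b [Za Zb ->]]]].
  by exists 0, 0; split; [exact: HullSum0 | exact: HullSum0 | rewrite addr0].
case: Zz => Zz; first by exists (w + a), b; split=> //; rewrite ?addrA //; apply: HullSumD Zz zw Za.
by exists a, (w + b); split=> //; [apply: HullSumD Zz zw Zb | rewrite addrCA].
Qed.

Lemma hull_sum_sub Z K : pure K -> Z `<=` K -> hull_sum Z `<=` K.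
Proof.
move=> pK ZK v; elim=> [|z w u Zz zw _ Ku]; first by case: pK.
by apply: pureD => //; apply: (hull_sub pK (ZK _ Zz)).
Qed.

Lemma hull_sum_map f Z Z' v : linear f -> (forall z, Z z -> Z' (f z)) ->
  hull_sum Z v -> hull_sum Z' (f v).
Proof.
move=> fl ZZ'; elim=> [|z w u Zz zw _ IH]; first by rewrite (linear_map0 fl); apply: HullSum0.
rewrite (linear_mapD _ _ fl); apply: HullSumD (ZZ' _ Zz) _ IH; exact: hull_map.
Qed.

(* [K] is the internal direct sum of the rank one modules [hull z], [z \in Z]. *)
Definition basis K Z : Prop :=
  [/\ forall z, Z z -> K z /\ z <> 0,
      forall z w, Z z -> hull z w -> hull_sum (Z `\ z) w -> w = 0
    & K `<=` hull_sum Z].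

Lemma basis0 : basis [set 0] set0.
Proof. by split=> // _ ->; apply: HullSum0. Qed.

Lemma basis1 y : y <> 0 -> basis (hull y) [set y].
Proof.
move=> y0; split=> [z ->|z w -> yw|w yw]; first by split; first exact: hull_id.
  by rewrite setDv; case=> // ? ? ? [].
exact: hull_sum_hull yw.
Qed.

(** A relation splits into its parts over [Z] and [Z']. Since [K] and [K'] meet in 0, the part on
    the side away from [z] vanishes, and independence within one side finishes. *)
Lemma basisU K K' K2 Z Z' : pure K -> pure K' -> basis K Z -> basis K' Z' ->
  K `&` K' `<=` [set 0] -> K `<=` K2 -> K' `<=` K2 ->
  (forall v, K2 v -> exists u u', [/\ K u, K' u' & v = u + u']) ->
  basis K2 (Z `|` Z').
Proof.
move=> pK pK' [ZK Zi Zs] [Z'K Z'i Z's] KK' KK2 K'K2 K2D.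
have ZsubK : Z `<=` K by move=> z /ZK[].
have Z'subK : Z' `<=` K' by move=> z /Z'K[].
split=> [z [/ZK[Kz z0]|/Z'K[Kz z0]]|z w Zz zw|v /K2D[u [u' [/Zs Zu /Z's Zu' ->]]]].
- by split=> //; apply: KK2.
- by split=> //; apply: K'K2.
- rewrite setDUl => /hull_sumU[u [u' [su su' wE]]].
  have Ku : K u by apply: hull_sum_sub su => // x [Zx _]; apply: ZsubK.
  have Ku' : K' u' by apply: hull_sum_sub su' => // x [Zx _]; apply: Z'subK.
  case: Zz => Zz.
    have Kw : K w by apply: (hull_sub pK (ZsubK _ Zz)).
    have u'0 : u' = 0.
      by apply: KK'; split=> //; rewrite -[u'](addKr u) -wE addrC; apply: pureB.
    by apply: (Zi z) => //; rewrite wE u'0 addr0.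
  have Kw : K' w by apply: (hull_sub pK' (Z'subK _ Zz)).
  have u0 : u = 0.
    by apply: KK'; split=> //; rewrite -[u](addrK u') -wE; apply: pureB.
  by apply: (Z'i z) => //; rewrite wE u0 add0r.
- by apply: hull_sum_add; [apply: hull_sumS Zu => x; left | apply: hull_sumS Zu' => x; right].
Qed.

(** [f] restricts to an isomorphism from [K] onto [K2] with inverse [g], so relations among the
    images pull back along [g]. *)
Lemma basis_image f g K K2 Z : linear f -> linear g -> basis K Z ->
  (forall v, K v -> g (f v) = v) -> (forall v, K v -> K2 (f v)) ->
  (forall v, K2 v -> exists2 u, K u & v = f u) ->
  basis K2 (f @` Z).
Proof.
move=> fl gl [ZK Zi Zs] gf fK K2f; split=> [_ [z /ZK[Kz z0] <-]|_ w [z Zz <-] zw sw|v].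
- split; first exact: fK.
  by move=> fz0; apply: z0; rewrite -(gf z Kz) fz0 linear_map0.
- have [Kz _] := ZK z Zz; have gw0 : g w = 0.
    apply: (Zi z) => //; first by rewrite -(gf z Kz); apply: hull_map.
    apply: hull_sum_map sw => // _ [[x Zx <-] fxz]; have [Kx _] := ZK x Zx.
    by rewrite gf //; split=> // xz; apply: fxz; rewrite /= xz.
  have [r [s [r0 rw]]] := zw; apply: (scaler_regular r0).
  have sz0 : s *: z = 0.
    by rewrite -{1}(gf z Kz) -(linear_mapZ _ _ gl) -rw (linear_mapZ _ _ gl) gw0 scaler0.
  by rewrite scaler0 rw -(linear_mapZ _ _ fl) sz0 linear_map0.
- by case/K2f=> u /Zs su ->; apply: hull_sum_map su => // z Zz; exists z.
Qed.

(** A relation involves finitely many elements, so it already lives in one member of the chain. *)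
Lemma basis_bigcup (T : Type) (K Z : T -> set M) K2 :
  (forall t, basis (K t) (Z t)) ->
  (forall t t', Z t `<=` Z t' \/ Z t' `<=` Z t) ->
  (forall t, K t `<=` K2) -> (forall v, K2 v -> exists t, K t v) ->
  basis K2 [set z | exists t, Z t z].
Proof.
move=> bKZ chain KK2 K2K; split=> [z [t Zz]|z w [t Zz] zw sw|v /K2K[t Kv]].
- by have [/(_ z Zz)[Kz z0] _ _] := bKZ t; split=> //; apply: (KK2 t).
- have [t' [Z'z sw']] : exists t', Z t' z /\ hull_sum (Z t' `\ z) w.
    elim: sw {zw} => [|x u v [[t1 Zx] xz] xu _ [t2 [Zz2 sv]]].
      by exists t; split=> //; apply: HullSum0.
    have [Z12|Z21] := chain t1 t2; [exists t2|exists t1]; split=> //.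
    + by apply: HullSumD xu sv; split=> //; apply: Z12.
    + exact: Z21.
    + by apply: HullSumD xu _ => //; apply: hull_sumS sv => y [Zy yz]; split=> //; apply: Z21.
  by have [_ Zi _] := bKZ t'; apply: Zi Z'z zw sw'.
- by have [_ _ Zs] := bKZ t; apply: hull_sumS (Zs v Kv) => z Zz; exists t.
Qed.

End Bases.

(* [phi] identifies [M] with the direct sum of the fractional modules [J i]. *)
Record coordinates (R : idomainType) (M : lmodType R) (I : choiceType)
    (J : I -> set (quotfield R)) (phi : M -> I -> quotfield R) : Prop :=
  Coordinates {
    coord_submodule : forall i, submodule (J i);
    coord_nonzero : forall i, exists2 q, J i q & q != 0;
    coord_linear : forall r u v i, phi (r *: u + v) i = r *: phi u i + phi v i;
    coord_mem : forall u i, J i (phi u i);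
    coord_inj : forall u v, (forall i, phi u i = phi v i) -> u = v;
    coord_finite : forall u, exists s : seq I, forall i, phi u i != 0 -> i \in s;
    coord_surj : forall h (s : seq I), (forall i, h i != 0 -> i \in s) ->
      (forall i, J i (h i)) -> exists u, forall i, phi u i = h i }.

(** * Supports, projections, types, and retractions in coordinates *)

Section Coordinates.
Variables (R : idomainType) (M : lmodType R) (I : choiceType).
Local Notation Q := (quotfield R).
Local Notation "r %:K" := (toquot r) (at level 1, format "r %:K").
Variables (J : I -> set Q) (phi : M -> I -> Q).
Hypothesis crd : coordinates J phi.
Implicit Types (A B U : set I) (e f : M -> M) (s : seq I).

Lemma coords0 i : phi 0 i = 0.
Proof. by have := coord_linear crd (-1) 0 0 i; rewrite scaler0 addr0 scaleN1r addNr. Qed.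

Lemma coordsZ r u i : phi (r *: u) i = r *: phi u i.
Proof. by have := coord_linear crd r u 0 i; rewrite coords0 !addr0. Qed.

Lemma coordsD u v i : phi (u + v) i = phi u i + phi v i.
Proof. by have := coord_linear crd 1 u v i; rewrite !scale1r. Qed.

Lemma coordsB u v i : phi (u - v) i = phi u i - phi v i.
Proof. by rewrite -scaleN1r coordsD coordsZ scaleN1r. Qed.

Lemma scale_quot_eq0 (r : R) (q : Q) : (r *: q == 0) = (r == 0) || (q == 0).
Proof. by rewrite scale_quotE mulf_eq0 toquot_eq0. Qed.

Lemma coord_torsion_free (r : R) (x : M) : r *: x = 0 -> r = 0 \/ x = 0.
Proof.
move=> rx; have [r0|r0] := eqVneq r 0; [by left | right].
apply: (coord_inj crd) => i; rewrite coords0.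
by have /eqP := coordsZ r x i; rewrite rx coords0 eq_sym scale_quot_eq0 (negPf r0) => /eqP.
Qed.

Definition supp A : set M := [set v | forall i, phi v i != 0 -> A i].

Lemma suppN A v i : supp A v -> ~ A i -> phi v i = 0.
Proof. by move=> Av nA; apply/eqP; apply: contra_notT nA => /Av. Qed.

Lemma supp_pure A : pure (supp A).
Proof.
split=> [i|r u v Au Av i|r v r0 Av i vi]; first by rewrite coords0 eqxx.
  rewrite (coord_linear crd); apply: contraNP => nA.
  by rewrite (suppN Au nA) (suppN Av nA) scaler0 addr0.
by apply: Av; rewrite coordsZ scale_quot_eq0 negb_or r0.
Qed.

Lemma suppS A B : A `<=` B -> supp A `<=` supp B.
Proof. by move=> AB v Av i /Av /AB. Qed.

Lemma proj_exists A v : exists u, forall i, phi u i = if `[< A i >] then phi v i else 0.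
Proof.
have [s sv] := coord_finite crd v.
apply: (coord_surj crd (s := s)) => i; case: ifP => // _.
- exact: sv.
- by rewrite eqxx.
- exact: (coord_mem crd).
- by have [] := (submoduleE _).1 (coord_submodule crd i).
Qed.

Definition proj A v : M := projT1 (cid (proj_exists A v)).

Lemma projE A v i : phi (proj A v) i = if `[< A i >] then phi v i else 0.
Proof. by rewrite /proj; case: cid. Qed.

Lemma proj_out A v i : ~ A i -> phi (proj A v) i = 0.
Proof. by move=> Ai; rewrite projE asboolF. Qed.

Lemma proj_linear A : linear (proj A).
Proof.
move=> r u v; apply: (coord_inj crd) => i.
by rewrite (coord_linear crd) !projE; case: ifP; rewrite ?(coord_linear crd) ?scaler0 ?addr0.
Qed.

Lemma supp_proj A v : supp A (proj A v).
Proof. by move=> i; rewrite projE; case: asboolP; rewrite ?eqxx. Qed.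

Lemma proj_id A v : supp A v -> proj A v = v.
Proof.
move=> Av; apply: (coord_inj crd) => i; rewrite projE; case: asboolP => // /(suppN Av).
by move->.
Qed.

Lemma proj0 A B v : supp B v -> A `&` B = set0 -> proj A v = 0.
Proof.
move=> Bv AB; apply: (coord_inj crd) => i; rewrite projE coords0; case: asboolP => // Ai.
by apply: (suppN Bv) => Bi; have : (A `&` B) i by []; rewrite AB.
Qed.

Lemma proj_compl A B v : supp B v -> supp (B `\` A) (v - proj A v).
Proof.
move=> Bv i; rewrite coordsB projE; case: asboolP => nAi; first by rewrite subrr eqxx.
by rewrite subr0 => /Bv.
Qed.

Lemma generators_exist : exists g : I -> M,
  forall i, phi (g i) i != 0 /\ forall j, j != i -> phi (g i) j = 0.
Proof.
suff /boolp.choice[g gP] : forall i, exists u, phi u i != 0 /\ forall j, j != i -> phi u j = 0.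
  by exists g.
move=> i; have [q Jq q0] := coord_nonzero crd i.
have [||u uE] := coord_surj crd (h := fun j => if j == i then q else 0) (s := [:: i]).
- by move=> j /=; case: (j =P i) => [->|]; rewrite ?mem_head ?eqxx.
- move=> j /=; case: (j =P i) => [->//|_].
  by have [] := (submoduleE _).1 (coord_submodule crd j).
by exists u; rewrite uE eqxx; split=> // j /negPf ji; rewrite uE ji.
Qed.

Section Generators.
Variable g : I -> M.
Hypothesis gP : forall i, phi (g i) i != 0 /\ forall j, j != i -> phi (g i) j = 0.

Lemma line_multiple i u : (forall j, j != i -> phi u j = 0) ->
  exists r d : R, d != 0 /\ d *: u = r *: g i.
Proof.
move=> ui; have [gi0 gij] := gP i; have [r [d [d0 dr]]] := quotfieldP (phi u i / phi (g i) i).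
exists r, d; split=> //; apply: (coord_inj crd) => j; rewrite !coordsZ.
have [->|ji] := eqVneq j i; last by rewrite ui // gij // !scaler0.
by rewrite !scale_quotE -dr -mulrA mulfVK.
Qed.

(** Coordinates are split off one at a time; each single-coordinate part has a nonzero multiple in
    [R (g i)], so purity puts it in [K]. Claims that define a pure set thus need checking on
    generators only. *)
Lemma pure_supp_ind (K : set M) B : pure K -> (forall i, B i -> K (g i)) ->
  supp B `<=` K.
Proof.
move=> pK Kg v Bv; have [s] := coord_finite crd v; elim: s v Bv => [|i s IHs] v Bv sv.
  suff -> : v = 0 by case: pK.
  by apply: (coord_inj crd) => i; rewrite coords0; apply/eqP; apply: contraT => /sv.
rewrite -(subrK (proj [set i] v) v); apply: pureD => //.
  have subv : supp (B `\` [set i]) (v - proj [set i] v) by apply: proj_compl.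
  apply: IHs => [j /subv[]//|j vj]; have [_ /= ji] := subv j vj.
  have : phi v j != 0 by rewrite coordsB proj_out // subr0 in vj.
  by move/sv; rewrite inE => /orP[/eqP|].
have [vi|vi] := eqVneq (phi v i) 0.
  suff -> : proj [set i] v = 0 by case: pK.
  apply: (coord_inj crd) => j; rewrite projE coords0.
  by case: asboolP => // ->.
have [j ji|r [d [d0 du]]] := @line_multiple i (proj [set i] v).
  by rewrite proj_out // => /eqP; rewrite (negPf ji).
have [_ _ KS] := pK; apply: (KS d) => //; rewrite du; apply: pureZ => //.
exact/Kg/Bv.
Qed.

End Generators.

Definition type_le i j : Prop := exists2 q : Q, q != 0 & forall z, J i z -> J j (q * z).

Lemma type_le_refl i : type_le i i.
Proof. by exists 1; rewrite ?oner_neq0 // => z; rewrite mul1r. Qed.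

Lemma type_le_trans i j k : type_le i j -> type_le j k -> type_le i k.
Proof.
move=> [p p0 pP] [q q0 qP]; exists (q * p); first by rewrite mulf_neq0.
by move=> z /pP/qP; rewrite mulrA.
Qed.

Definition up_closed U : Prop := forall i j, U i -> type_le i j -> U j.

(* Each component of [e] from [J i] to [J j] is multiplication by an element of Q. *)
Lemma supp_stable e U : linear e -> up_closed U ->
  forall v, supp U v -> supp U (e v).
Proof.
move=> el upU; have [g gP] := generators_exist.
apply: (pure_supp_ind gP (pure_preim el (supp_pure U))) => i Ui j egj.
apply: (upU i) => //; have [gi0 gij] := gP i.
exists (phi (e (g i)) j / phi (g i) i); first by rewrite mulf_neq0 ?invr_neq0.
(* [w] has [z] as its only coordinate, so it is a fractional multiple of [g i]; hence coordinate [j]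
   of [e w] is the proposed multiple of [z], and it lies in [J j]. *)
move=> z Jz; have [||w wE] := coord_surj crd (h := fun k => if k == i then z else 0) (s := [:: i]).
- by move=> k /=; case: (k =P i) => [->|]; rewrite ?mem_head ?eqxx.
- move=> k /=; case: (k =P i) => [->//|_].
  by have [] := (submoduleE _).1 (coord_submodule crd k).
have [k ki|r [d [d0 dw]]] := line_multiple gP (i := i) (u := w).
  by rewrite wE (negPf ki).
suff -> : phi (e (g i)) j / phi (g i) i * z = phi (e w) j by exact: (coord_mem crd).
have d0' : d%:K != 0 by rewrite toquot_eq0.
apply: (mulfI d0'); have := congr1 (phi^~ i) dw; rewrite !coordsZ wE eqxx => dz.
have := congr1 (fun v => phi (e v) j) dw; rewrite !(linear_mapZ _ _ el) !coordsZ => dew.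
rewrite -[RHS]scale_quotE dew mulrCA -[d%:K * z]scale_quotE dz !scale_quotE.
by field; rewrite gi0.
Qed.

Hypotheses (hl : h_local R) (pr : prufer R).

(* Pure rank one submodules of a homogeneous module are summands. *)
Lemma homogeneous_retraction y : y <> 0 ->
  (forall i j, phi y i != 0 -> phi y j != 0 -> type_le i j) ->
  exists2 c : M -> M, linear c & c y = y /\ forall v, hull y (c v).
Proof.
move=> y0 hom; have [s0 ys0] := coord_finite crd y.
pose s := undup [seq i <- s0 | phi y i != 0].
have sE i : (i \in s) = (phi y i != 0).
  by rewrite mem_undup mem_filter; case: eqP => //= /eqP /ys0.
(* Dividing coordinate [i] by [phi y i] turns [y] into the vector with all entries 1 on its
   support. *)
pose J' i : set Q := [set z | J i (phi y i * z)].
have subJ i := (submoduleE _).1 (coord_submodule crd i).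
have subJ' i : submodule (J' i).
  apply/submoduleE; have [J0 JD] := subJ i; split=> [|r u v Ju Jv]; rewrite /J' /=.
    by rewrite mulr0.
  by rewrite mulrDr scale_quotE mulrCA; apply: JD.
have sN0 : s != [::].
  apply/eqP => s0'; apply: y0; apply: (coord_inj crd) => i; rewrite coords0.
  by apply/eqP; apply: contraT; rewrite -sE s0'.
pose P (p : I * I) (r : R) := forall z, J' p.1 z -> J' p.2 (r *: z).
have [a a0 aP] : exists2 a : R, a != 0 & forall p, p \in [seq (i, j) | i <- s, j <- s] -> P p a.
  apply: common_multiplier; first exact: oner_neq0.
  - by move=> r t r0 t0; rewrite mulf_neq0.
  - by move=> p r t Pr z /Pr /(submoduleZ t (subJ' _)); rewrite scalerA.
  - move=> _ /allpairsP[[i j] /= [si sj ->]]; rewrite !sE in si sj.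
    have [q q0 qP] := hom i j si sj.
    (* The type inequality supplies a multiplier [q] in the field; the denominator [d] turns it into
       one in [R] for the rescaled modules. *)
    have [r [d [d0 dr]]] := quotfieldP (phi y j / (q * phi y i)); exists d => // z; rewrite /J' /= => Jz.
    have -> : phi y j * (d *: z) = r *: (q * (phi y i * z)).
      rewrite !scale_quotE -dr invfM !mulrA; congr (_ * _).
      by rewrite [RHS]mulrAC !mulfVK // mulrC.
    by apply: (submoduleZ _ (coord_submodule crd j)); apply: qP.
have [rho rho1 rhoP] : exists2 rho : I -> Q, \sum_(i <- s) rho i = 1 &
    forall i j z, i \in s -> j \in s -> J' i z -> J' j (rho i * z).
  apply: (partition_of_unity hl pr subJ' (undup_uniq _) sN0 a0) => i j z si sj.
  by apply: (aP (i, j)); apply/allpairsP; exists (i, j).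
(* [F v] is the coefficient of [y] in the retraction: [c v] will be [F v] times [y], and the sum of
   the [rho i] being 1 gives [c y = y]. *)
pose F v := \sum_(i <- s) rho i * (phi v i / phi y i).
have FJ v j : J j (F v * phi y j).
  have [sj|] := boolP (j \in s); last first.
    by rewrite sE negbK => /eqP->; rewrite mulr0; have [] := subJ j.
  suff : J' j (F v) by rewrite /J' /= mulrC.
  rewrite /F big_seq; apply: big_ind => [|u w|i si].
  - by have [] := (submoduleE _).1 (subJ' j).
  - exact: submoduleD.
  - by apply: (rhoP i) => //; rewrite /J' /= mulrC mulfVK -?sE //; exact: (coord_mem crd).
have [c cE] : exists c : M -> M, forall v i, phi (c v) i = F v * phi y i.
  suff /boolp.choice[c cE] : forall v, exists w, forall i, phi w i = F v * phi y i by exists c.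
  move=> v; apply: (coord_surj crd (s := s)) => // i.
  by rewrite mulf_eq0 negb_or sE => /andP[].
have Flin r u v : F (r *: u + v) = r *: F u + F v.
  rewrite /F scaler_sumr -big_split /=; apply: eq_bigr => i _.
  by rewrite (coord_linear crd) !scale_quotE; ring.
exists c.
  move=> r u v; apply: (coord_inj crd) => i.
  by rewrite (coord_linear crd) !cE Flin !scale_quotE; ring.
split=> [|v].
  apply: (coord_inj crd) => i; rewrite cE /F.
  rewrite (eq_big_seq rho) ?rho1 ?mul1r // => k; rewrite sE => yk.
  by rewrite divff // mulr1.
have [r [d [d0 dr]]] := quotfieldP (F v); exists d, r; split=> //.
by apply: (coord_inj crd) => i; rewrite !coordsZ cE !scale_quotE -dr mulrA.
Qed.

End Coordinates.

(** * Summands of finite and of countable rank *)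

Section Summands.
Variables (R : idomainType) (M : lmodType R) (I : choiceType).
Variables (J : I -> set (quotfield R)) (phi : M -> I -> quotfield R).
Hypothesis crd : coordinates J phi.
Implicit Types (A D U : set I) (Z : set M) (e f p c : M -> M) (s : seq I).

Local Notation tfM := (coord_torsion_free crd).
Local Notation supp := (supp phi).
Local Notation proj := (proj crd).
Local Notation type_le := (type_le J).

Definition fix_set f : set M := [set v | f v = v].

Lemma fix_set_pure f : linear f -> pure (fix_set f).
Proof. by move=> fl; apply: (pure_eq tfM fl (g := id)). Qed.

(* Equivalently, the image of [f] is a summand of the image of [e]. *)
Record summand e f Z : Prop := Summand {
  summand_linear : linear f;
  summand_idem : forall v, f (f v) = f v;
  summand_left : forall v, e (f v) = f v;
  summand_right : forall v, f (e v) = f v;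
  summand_basis : basis (fix_set f) Z }.

Lemma summand0 e : linear e -> summand e (fun=> 0) set0.
Proof.
move=> el; split=> //; first by move=> r u v; rewrite scaler0 addr0.
  by move=> v; rewrite (linear_map0 el).
suff -> : fix_set (fun=> 0) = [set 0] by apply: basis0.
by rewrite eqEsubset; split=> v /= ->.
Qed.

(** The condition [p e p = p e] makes the compression [p e p] idempotent, and [e] maps its image
    injectively with inverse [p]. A summand of the compression is therefore carried by [e] to a
    summand of the image of [e]. *)
Lemma summand_lift e p f Z : linear e -> linear p ->
  (forall v, e (e v) = e v) -> (forall v, p (p v) = p v) ->
  (forall v, p (e (p v)) = p (e v)) ->
  summand (p \o e \o p) f Z -> summand e (e \o f \o p \o e) (e @` Z).
Proof.
move=> el pl ee pp pep [fl ff /= pepf fpep bZ].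
have pf v : p (f v) = f v by rewrite -pepf pp.
have pef v : p (e (f v)) = f v by rewrite -pep pepf.
have fpe v : f (p (e v)) = f v by rewrite -pep fpep.
split=> /= [|v|v|v|].
- exact: linear_comp (linear_comp (linear_comp el fl) pl) el.
- by rewrite ee pef ff.
- by rewrite ee.
- by rewrite ee.
- apply: (basis_image tfM el pl bZ) => v.
  + by move=> fv; rewrite -fv pef.
  + by move=> fv; rewrite /fix_set /= ee fpe fv.
  + by move=> fv; exists (f (p (e v))); rewrite /fix_set //= ff.
Qed.

(** On [hull y], [e] is the identity and [f] is zero. So [c] after [e - f] is an idempotent
    orthogonal to [f] with image [hull y], and its sum with [f] projects onto the direct sum of the
    two images. *)
Lemma summand_add_line e f c Z y : linear e -> (forall v, e (e v) = e v) ->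
  summand e f Z -> linear c -> c y = y -> (forall v, hull y (c v)) ->
  e y = y -> f y = 0 -> y <> 0 ->
  summand e (fun v => f v + c (e v - f v)) (Z `|` [set y]).
Proof.
move=> el ee [fl ff ef fe bZ] cl cy hc ey fy y0.
have fp := pure_eq tfM fl (g := fun=> 0).
have zl : linear (fun _ : M => 0 : M) by move=> r u v; rewrite scaler0 addr0.
have fh v : hull y v -> f v = 0 by apply: (hull_sub (fp zl)).
have eh v : hull y v -> e v = v by apply: (hull_sub (fix_set_pure el)).
have ch v : hull y v -> c v = v by apply: (hull_sub (fix_set_pure cl)).
have fD := linear_mapD _ _ fl; have eD := linear_mapD _ _ el.
split=> [r u v|v|v|v|].
- have -> : e (r *: u + v) - f (r *: u + v) = r *: (e u - f u) + (e v - f v).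
    by rewrite el fl scalerBr opprD addrACA.
  by rewrite fl cl scalerDr addrACA.
- set w := c _; have hw : hull y w by apply: hc.
  rewrite fD eD ff ef (fh w hw) (eh w hw) addr0.
  by rewrite [f v + w]addrC addrK (ch w hw) addrC.
- by rewrite eD ef eh.
- by rewrite fe ee.
- apply: (basisU (fix_set_pure fl) (hull_pure y) bZ (basis1 y0)) => v.
  + by case=> /= fv hv; rewrite -fv fh.
  + by move=> fv; rewrite /fix_set /= -{2}fv ef fv subrr (linear_map0 cl) addr0.
  + by move=> hv; rewrite /fix_set /= fh // eh // subr0 add0r ch.
  + by move=> fv; exists (f v), (c (e v - f v)); split; rewrite /fix_set //=.
Qed.

Definition down_closed D : Prop := forall i j, D j -> type_le i j -> D i.

(** The complement of [D] is up-closed, so [e] preserves the kernel of [proj D]. *)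
Lemma proj_stable e D v : linear e -> down_closed D ->
  proj D (e (proj D v)) = proj D (e v).
Proof.
move=> el dD; apply/esym/eqP; rewrite -subr_eq0 -(linear_mapB _ _ (proj_linear _ D)).
rewrite -(linear_mapB _ _ el); apply/eqP; apply: (proj0 crd (B := ~` D)); last exact: setICr.
apply: (supp_stable crd) => //; first by move=> i j nDi ij /dD Di; apply: nDi; apply: Di.
have vT : supp setT v by [].
by have := proj_compl (crd := crd) (A := D) vT; rewrite setTD.
Qed.

Lemma supp_proj_sub A U v : supp U v -> supp (U `&` A) (proj A v).
Proof.
move=> Uv i vi; split; last exact: supp_proj vi.
by apply: Uv; move: vi; rewrite projE; case: ifP => //; rewrite eqxx.
Qed.

Lemma exists_maximal_type i0 s : exists2 i, i \in i0 :: s &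
  forall j, j \in i0 :: s -> type_le i j -> type_le j i.
Proof.
elim: s i0 => [|k s IHs] i0.
  exists i0; first exact: mem_head.
  by move=> j; rewrite inE => /eqP->.
have [i iks imax] := IHs k; have [ii0|nii0] := pselect (type_le i i0).
  exists i0; first exact: mem_head.
  move=> j; rewrite inE => /orP[/eqP->//|jks] i0j.
  exact: type_le_trans (imax j jks (type_le_trans ii0 i0j)) ii0.
exists i; first by rewrite inE iks orbT.
by move=> j; rewrite inE => /orP[/eqP->//|]; apply: imax.
Qed.

Hypotheses (hl : h_local R) (pr : prufer R).

(* Induction on the support of [x]: types not below it are projected away, those
   not below a non-maximal type are dealt with by induction, and the remaining
   component lies in the homogeneous part of a maximal type. *)
Lemma finite_rank_summand e x : linear e -> (forall v, e (e v) = e v) -> e x = x ->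
  exists f Z, summand e f Z /\ f x = x.
Proof.
move=> el ee ex; have [s sx] := coord_finite crd x.
(* The idempotent [e] is generalized too, since the induction hypothesis is applied to a compression
   of it. *)
have [n sn] := ubnP (size s); elim: n => // n IHn in s sn e x sx el ee ex *.
have {}sx : supp [set` s] x by move=> i /sx.
case: s => [|i0 s0] in sn sx *.
  exists (fun=> 0), set0; split; first exact: summand0.
  apply: (coord_inj crd) => i; rewrite (coords0 crd); apply/esym/eqP.
  by apply: contraT => /sx.
have [i1 si1 i1max] := exists_maximal_type i0 s0.
move: (i0 :: s0) => s in sn sx si1 i1max *.
pose below (s : seq I) : set I := [set i | exists2 j, j \in s & type_le i j].
have below_down (t : seq I) : down_closed (below t).
  by move=> i j [k tk jk] ij; exists k => //; apply: type_le_trans ij jk.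
have below_self (t : seq I) i : i \in t -> below t i.
  by move=> ti; exists i => //; apply: type_le_refl.
(* Entries above the maximal type of [i1] are dropped. At least [i1] goes, so [s'] is shorter. *)
pose s' := [seq j <- s | ~~ `[< type_le i1 j >]].
pose D := below s; pose D' := below s'; pose T' : set I := type_le i1.
have s'n : (size s' < n)%N.
  rewrite -ltnS; apply: leq_trans sn; rewrite ltnS size_filter -(count_predC (fun j => ~~ `[< type_le i1 j >])).
  rewrite -[X in (X < _)%N]addn0 ltn_add2l -has_count; apply/hasP; exists i1 => //=.
  by rewrite negbK; apply/asboolP/type_le_refl.
have D'T' : D' `&` T' = set0.
  rewrite -subset0 => i [[j]]; rewrite mem_filter => /andP[/asboolPn i1j _] ij i1i.
  by apply: i1j; apply: type_le_trans i1i ij.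
have upT' : up_closed J T' by move=> i j; apply: type_le_trans.
pose p := proj D; pose p' := proj D'.
have pl : linear p by apply: proj_linear.
have p'l : linear p' by apply: proj_linear.
have pp A v : proj A (proj A v) = proj A v by apply: proj_id; apply: supp_proj.
have pid v : p (p v) = p v := pp D v.
have p'id v : p' (p' v) = p' v := pp D' v.
have pep v : p (e (p v)) = p (e v) by apply: proj_stable => //; apply: below_down.
pose e1 := p \o e \o p.
have e1l : linear e1 := linear_comp (linear_comp pl el) pl.
have e1e1 v : e1 (e1 v) = e1 v by rewrite /e1 /= pid pep ee.
have px : p x = x by apply: proj_id => i /sx /= si; apply: below_self.
have e1x : e1 x = x by rewrite /e1 /= px ex px.
have p'e1p' v : p' (e1 (p' v)) = p' (e1 v).
  by apply: proj_stable => //; apply: below_down.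
pose e2 := p' \o e1 \o p'.
have e2l : linear e2 := linear_comp (linear_comp p'l e1l) p'l.
have e2e2 v : e2 (e2 v) = e2 v by rewrite /e2 /= p'id p'e1p' e1e1.
have e2x : e2 (p' x) = p' x by rewrite /e2 /= p'id p'e1p' e1x.
(* The induction hypothesis treats the part of [x] lying below the remaining types. *)
have [f [Z [sumf fx]]] : exists f Z, summand e2 f Z /\ f (p' x) = p' x.
  apply: (IHn s') => // i; rewrite projE; case: asboolP => [[j s'j ij] xi|]; last by rewrite eqxx.
  rewrite mem_filter (sx i xi) andbT; apply/asboolPn => i1i.
  move: s'j; rewrite mem_filter => /andP[/asboolPn i1j _].
  by apply: i1j; apply: type_le_trans i1i ij.
(* Lifted to [e1], the summand accounts for [f1 x = e1 (p' x)]; [y] is what is left of [x]. *)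
have sumf1 := summand_lift e1l p'l e1e1 p'id p'e1p' sumf.
set f1 := _ \o e1 in sumf1; pose y := x - f1 x.
suff [f2 [Z2 [sumf2 f2x]]] : exists f2 Z2, summand e1 f2 Z2 /\ f2 x = x.
  exists (e \o f2 \o p \o e), (e @` Z2); split; first exact: (summand_lift el pl ee pid pep).
  by rewrite /= ex px f2x ex.
have [y0|y0] := pselect (y = 0).
  by exists f1, (e1 @` Z); split=> //; apply/esym/eqP; rewrite -subr_eq0; apply/eqP.
have yE : y = e1 (x - p' x).
  by rewrite /y /f1 /= e1x fx (linear_mapB _ _ e1l) e1x.
have yT : supp (T' `&` D) y.
  rewrite yE; apply: supp_proj_sub; apply: (supp_stable crd el upT').
  apply: (suppS (A := T' `&` D)); first by move=> i [].
  apply: supp_proj_sub; apply: (suppS _ (proj_compl (crd := crd) sx)) => i [/= si nD'].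
  apply: contrapT => i1i; apply: nD'; apply: below_self; rewrite mem_filter si andbT.
  exact/asboolPn.
(* Any index [i] in the support of [y] is above [i1] and below some [k] in [s]; maximality gives [k]
   below [i1], so all types in the support are equivalent. *)
have [c cl [cy hc]] : exists2 c : M -> M, linear c & c y = y /\ forall v, hull y (c v).
  apply: (homogeneous_retraction crd hl pr y0) => i j /yT[i1i [k sk ik]] /yT[i1j _].
  exact: type_le_trans ik (type_le_trans (i1max k sk (type_le_trans i1i ik)) i1j).
have e1y : e1 y = y by rewrite yE e1e1.
have f1y : f1 y = 0.
  have p'y : p' y = 0 by apply: (proj0 crd (B := T' `&` D) yT); rewrite setIA D'T' set0I.
  by rewrite /f1 /= e1y p'y (linear_map0 (summand_linear sumf)) (linear_map0 e1l).
exists (fun v => f1 v + c (e1 v - f1 v)), ((e1 @` Z) `|` [set y]).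
split; first exact: summand_add_line.
by rewrite e1x cy /y addrC subrK.
Qed.

(** The finite rank lemma is applied to the idempotent [e - f] and the element [x - f x]. The
    resulting [h] is orthogonal to [f], so [f + h] is again idempotent, and it fixes [x]. *)
Lemma summand_extend e f Z x : linear e -> (forall v, e (e v) = e v) -> e x = x ->
  summand e f Z -> exists f' Z',
    [/\ summand e f' Z', fix_set f `<=` fix_set f', Z `<=` Z' & f' x = x].
Proof.
move=> el ee ex [fl ff ef fe bZ].
pose e' v := e v - f v.
have e'l : linear e'.
  by move=> r u v; rewrite /e' el fl scalerBr opprD addrACA.
have e'e' v : e' (e' v) = e' v.
  by rewrite /e' (linear_mapB _ _ el) (linear_mapB _ _ fl) ee ef fe ff subrr subr0.
have e'x : e' (e' x) = e' x by [].
have [h [Y [[hl' hh e'h he' bY] hx]]] := finite_rank_summand e'l e'e' e'x.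
have fe' v : f (e' v) = 0 by rewrite /e' (linear_mapB _ _ fl) fe ff subrr.
have e'f v : e' (f v) = 0 by rewrite /e' ef ff subrr.
have fh v : f (h v) = 0 by rewrite -e'h fe'.
have hf v : h (f v) = 0 by rewrite -he' e'f (linear_map0 hl').
have eh v : e (h v) = h v by rewrite -{2}e'h /e' fh subr0.
have he v : h (e v) = h v by rewrite -[RHS]he' /e' (linear_mapB _ _ hl') hf subr0.
exists (fun v => f v + h v), (Z `|` Y).
have fhfix : fix_set f `<=` fix_set (fun v => f v + h v).
  by move=> v fv; rewrite /fix_set /= -{2}fv hf addr0.
split; [|exact: fhfix|by move=> z; left|]; last first.
  by rewrite -[h x]he' hx /e' ex addrC subrK.
split=> [r u v|v|v|v|].
- by rewrite fl hl' scalerDr addrACA.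
- by rewrite (linear_mapD _ _ fl) (linear_mapD _ _ hl') ff fh hf hh addr0 add0r.
- by rewrite (linear_mapD _ _ el) ef eh.
- by rewrite fe he.
- apply: (basisU (fix_set_pure fl) (fix_set_pure hl') bZ bY) => // v.
  + by case=> /= fv <-; rewrite -fv hf.
  + by move=> hv; rewrite /fix_set /= -{1}hv fh hv add0r.
  + by move=> fhv; exists (f v), (h v); split; rewrite /fix_set //=.
Qed.

(** The elements [xs n] are absorbed one by one into growing summands with nested bases. The union
    of these summands is pure and contains every [xs n], hence is the whole image of [e]. *)
Lemma countable_rank_basis e (xs : nat -> M) : linear e -> (forall v, e (e v) = e v) ->
  (forall n, e (xs n) = xs n) ->
  (forall K, pure K -> (forall n, K (xs n)) -> fix_set e `<=` K) ->
  exists Z, basis (fix_set e) Z.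
Proof.
move=> el ee exs gen.
(* The step is made total, returning its input when that is not a summand, so that choice yields a
   function to iterate. *)
have step (a : ((M -> M) * set M) * nat) : exists b : (M -> M) * set M,
    summand e a.1.1 a.1.2 ->
    [/\ summand e b.1 b.2, fix_set a.1.1 `<=` fix_set b.1, a.1.2 `<=` b.2
      & b.1 (xs a.2) = xs a.2].
  have [sa|nsa] := pselect (summand e a.1.1 a.1.2); last by exists a.1.
  have [f [Z [? ? ? ?]]] := summand_extend el ee (exs a.2) sa.
  by exists (f, Z) => _; split.
have [F FP] := boolp.choice step.
pose st := fix st n := if n is n'.+1 then F (st n', n') else ((fun=> 0 : M), set0).
have sst n : summand e (st n).1 (st n).2.
  elim: n => [|n IHn]; first exact: summand0.
  by have [] := FP (st n, n) IHn.
have stS n : [/\ fix_set (st n).1 `<=` fix_set (st n.+1).1, (st n).2 `<=` (st n.+1).2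
    & (st n.+1).1 (xs n) = xs n] by have [] := FP (st n, n) (sst n).
have mono m n : (m <= n)%N ->
    fix_set (st m).1 `<=` fix_set (st n).1 /\ (st m).2 `<=` (st n).2.
  elim: n => [|n IHn]; first by rewrite leqn0 => /eqP->; split.
  rewrite leq_eqVlt => /orP[/eqP->|]; first by split.
  rewrite ltnS => /IHn[fmn Zmn].
  by have [fS ZS _] := stS n; split; [apply: subset_trans fS | apply: subset_trans ZS].
exists [set z | exists n, (st n).2 z].
apply: (basis_bigcup (K := fun n => fix_set (st n).1)) => [n|m n|n v fv|v ev].
- exact: summand_basis (sst n).
- by case: (leqP m n) => [|/ltnW] /mono[_ ?]; [left|right].
- have fv' : (st n).1 v = v := fv.
  by rewrite /fix_set /= -[in LHS]fv' (summand_left (sst n)).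
- apply: (gen [set v | exists n, fix_set (st n).1 v]) => // [|n]; last first.
    by exists n.+1; have [] := stS n.
  split=> [|r u w [m fu] [n fw]|r w r0 [n fw]].
  + by exists 0%N.
  + exists (maxn m n); have [_ fD _] := fix_set_pure (summand_linear (sst (maxn m n))).
    by apply: fD; [apply: (mono _ _ (leq_maxl m n)).1 | apply: (mono _ _ (leq_maxr m n)).1].
  + by exists n; have [_ _ fS] := fix_set_pure (summand_linear (sst n)); exact: (fS r w r0 fw).
Qed.

End Summands.

(** * Kaplansky's reduction to countable rank *)

Section Kaplansky.
Variables (R : idomainType) (M : lmodType R) (I : choiceType).
Variables (J : I -> set (quotfield R)) (phi : M -> I -> quotfield R).
Hypothesis crd : coordinates J phi.
Hypotheses (hl : h_local R) (pr : prufer R).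
Variable e : M -> M.
Hypotheses (el : linear e) (ee : forall v, e (e v) = e v).
Implicit Types (A B C : set I) (Z : set M).

Local Notation tfM := (coord_torsion_free crd).
Local Notation supp := (supp phi).
Local Notation proj := (proj crd).

Definition stable A : Prop := forall v, supp A v -> supp A (e v).

(** Starting from [i0], the supports of the [e (g i)] are added repeatedly. Each is finite, so every
    generation is finite and the union is countable. *)
Lemma stable_closure i0 : exists C, [/\ C i0, countable C &
  forall A, stable A -> stable (A `|` C)].
Proof.
have [g gP] := generators_exist crd.
pose Cn := fix Cn n := if n is n'.+1 then
  \bigcup_(i in Cn n') [set j | phi (e (g i)) j != 0] else [set i0].
pose C := \bigcup_n Cn n; exists C; split=> [||A stA].
- by exists 0%N.
- apply: bigcup_countable => // n _; apply: finite_set_countable.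
  elim: n => [|n IHn] /=; first exact: finite_set1.
  apply: bigcup_finite => // i _; have [s si] := coord_finite crd (e (g i)).
  by apply: (sub_finite_set (B := [set` s])); [exact: si | exact: finite_seq].
- apply: (pure_supp_ind crd gP); first exact: pure_preim (supp_pure crd _).
  move=> i [Ai|[n _ Cni]] j egj.
    left; apply: (stA (g i)) egj => k gk.
    by have [->//|/(gP i).2 gk0] := eqVneq k i; rewrite gk0 eqxx in gk.
  by right; exists n.+1 => //; exists i.
Qed.

(* [q e q] is an idempotent whose image complements that of [e] on [supp A]. *)
Lemma basis_extend A C Z : stable A -> stable (A `|` C) -> countable C ->
  basis (supp A `&` fix_set e) Z ->
  exists2 Z', Z `<=` Z' & basis (supp (A `|` C) `&` fix_set e) Z'.
Proof.
move=> stA stAC cC bZ; have [g gP] := generators_exist crd.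
pose B := C `\` A; pose q := proj B.
have ql : linear q by apply: proj_linear.
have qq v : q (q v) = q v by apply: proj_id; apply: supp_proj.
have qA v : supp A v -> q v = 0.
  by move=> Av; apply: (proj0 crd Av); rewrite /B setDE -setIA setICl setI0.
have Bsub v : supp B v -> supp (A `|` C) v by apply: suppS => i [Ci _]; right.
have Aq v : supp (A `|` C) v -> supp A (v - q v).
  move=> ACv; apply: (suppS _ (proj_compl (crd := crd) ACv)) => i [[//|Ci] nB].
  by apply: contrapT => nA; apply: nB.
have qeq v : supp (A `|` C) v -> q (e (q v)) = q (e v).
  move=> ACv; apply/esym/eqP; rewrite -subr_eq0 -(linear_mapB _ _ ql) -(linear_mapB _ _ el).
  by apply/eqP/qA/stA/Aq.
pose h := q \o e \o q.
have hlin : linear h := linear_comp (linear_comp ql el) ql.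
have ACq v : supp (A `|` C) (q v) by apply: Bsub; apply: supp_proj.
have hh v : h (h v) = h v by rewrite /h /= qq qeq ?ee //; apply: stAC.
have hfix v : h v = v -> q v = v by move=> <-; rewrite /h /= qq.
have [Y bY] : exists Y, basis (fix_set h) Y.
  have /countable_injP[k kinj] := cC.
  have /boolp.choice[xs xsP] : forall n, exists x, h x = x /\
      forall i, C i -> k i = n -> x = h (g i).
    move=> n; have [[i [Ci kin]]|ni] := pselect (exists i, C i /\ k i = n).
      exists (h (g i)); split=> // j Cj kjn; congr (h (g _)).
      by apply: kinj; rewrite ?inE // kin kjn.
    exists 0; split=> [|i Ci kin]; first exact: linear_map0.
    by case: ni; exists i.
  apply: (countable_rank_basis crd hl pr (xs := xs)) => // [n|K pK Kxs v hv].
    by have [] := xsP n.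
  rewrite -[v]hv; apply: (pure_supp_ind crd gP (pure_preim hlin pK) (B := C)).
    move=> i Ci /=; have [_ xsk] := xsP (k i).
    by rewrite -(xsk i Ci erefl).
  rewrite -[v]hfix //; apply: (suppS (A := B)) => [i []//|]; exact: supp_proj.
(* [K'] is the complement being added: [e] maps the image of [h] isomorphically onto it, with
   inverse [q]. *)
pose K' : set M := supp (A `|` C) `&` fix_set (e \o q).
have eql : linear (e \o q) := linear_comp el ql.
exists (Z `|` e @` Y); first by move=> z; left.
have pA := pureI (supp_pure crd A) (fix_set_pure crd el).
have K'E v : K' v -> e (q v) = v by case.
have pK' : pure K' by apply: pureI (supp_pure crd _) (fix_set_pure crd eql).
apply: (basisU pA pK' bZ (K' := K')).
- apply: (basis_image tfM el ql bY) => [v hv|v hv|v /K'E qv].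
  + by rewrite -[in LHS](hfix v hv).
  + split; first by apply: stAC; apply: Bsub; rewrite -(hfix v hv); apply: supp_proj.
    by rewrite /fix_set /= -{1}(hfix v hv) -[q (e (q v))]/(h v) hv.
  + by exists (q v) => //; rewrite /fix_set /h /= qq qv.
- by move=> v [[Av _] /K'E qv]; rewrite /= -qv qA // linear_map0.
- by move=> v [Av ev]; split=> //; apply: (suppS _ Av) => i; left.
- move=> v K'v; split; first by case: K'v.
  by rewrite /fix_set /= -(K'E v K'v) ee.
(* Split [v = (v - q v) + q v] and apply [e], which fixes [v]; the first part is supported in
   [A]. *)
- move=> v [ACv ev]; exists (e (v - q v)), (e (q v)); split.
  + by split; [apply/stA/Aq | rewrite /fix_set /= ee].
  + split; first exact/stAC/ACq.
    by rewrite /fix_set /= -[v in RHS]ev; congr e; rewrite qeq // ev.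
  + by rewrite -(linear_mapD _ _ el) subrK ev.
Qed.

(** Zorn's lemma applies to stable index sets paired with a basis of the corresponding part of the
    image, both components growing. A maximal pair uses every index, as otherwise a countable
    extension would enlarge it. *)
Lemma summand_basis_exists : exists Z, basis (fix_set e) Z.
Proof.
pose good (t : set I * set M) := stable t.1 /\ basis (supp t.1 `&` fix_set e) t.2.
pose T := {t | good t}.
pose le (t u : T) : bool :=
  `[< (sval t).1 `<=` (sval u).1 /\ (sval t).2 `<=` (sval u).2 >].
have good0 : good (set0, set0).
  have supp0 v : supp set0 v -> v = 0.
    move=> v0; apply: (coord_inj crd) => i; rewrite (coords0 crd); apply/eqP.
    by apply: contraT => /v0.
  split=> [v /supp0-> i|/=]; first by rewrite linear_map0 // (coords0 crd) eqxx.
  suff -> : supp set0 `&` fix_set e = [set 0] by apply: basis0.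
  rewrite eqEsubset; split=> v; first by case=> /supp0.
  by move=> ->; split; [move=> i; rewrite (coords0 crd) eqxx | apply: linear_map0].
have [||C Ctot|[[A Z] [/= stA bZ]] tmax] := @ZL_preorder T (exist _ _ good0) le.
- by move=> t; apply/asboolP; split.
- move=> r s t /asboolP[rs1 rs2] /asboolP[st1 st2]; apply/asboolP.
  by split; [apply: subset_trans st1 | apply: subset_trans st2].
- have [[t0 Ct0]|noC] := pselect (exists t, C t); last first.
    by exists (exist _ _ good0) => t Ct; case: noC; exists t.
  pose A := [set i | exists t : {t | C t}, (sval (sval t)).1 i].
  pose Z := [set z | exists t : {t | C t}, (sval (sval t)).2 z].
  have chain t u : C t -> C u -> le t u \/ le u t by apply: Ctot.
  (* Supports are finite, so a vector supported in the union of a chain is supported in one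
     member. *)
  have suppA v : supp A v -> exists2 t, C t & supp (sval t).1 v.
    move=> Av; have [s sv] := coord_finite crd v.
    have [t Ct ts] : exists2 t, C t & forall i, i \in s -> phi v i != 0 -> (sval t).1 i.
      elim: s {sv} => [|i s [t Ct ts]]; first by exists t0.
      have [vi|vi] := eqVneq (phi v i) 0.
        by exists t => // j; rewrite inE => /orP[/eqP->|/ts//]; rewrite vi eqxx.
      have [[u Cu] /= ui] := Av i vi.
      have [/asboolP[tu _]|/asboolP[ut _]] := chain t u Ct Cu.
        by exists u => // j; rewrite inE => /orP[/eqP->//|js vj]; apply/tu/ts.
      by exists t => // j; rewrite inE => /orP[/eqP-> _|]; [apply: ut | apply: ts].
    by exists t => // i vi; apply: ts => //; apply: sv.
  have gAZ : good (A, Z).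
    split=> /= [v /suppA[t Ct tv]|].
      have [stt _] := svalP t; move=> i evi; exists (exist _ t Ct).
      exact: stt evi.
    apply: (basis_bigcup (K := fun t : {t | C t} => supp (sval (sval t)).1 `&` fix_set e)
        (Z := fun t => (sval (sval t)).2)) => [t|t u|t|v [/suppA[t Ct tv] ev]].
    + by have [] := svalP (sval t).
    + by have [/asboolP[]|/asboolP[]] := chain _ _ (svalP t) (svalP u); [left|right].
    + by move=> v [tv ev]; split=> // i /tv ti; exists t.
    + by exists (exist _ t Ct).
  exists (exist _ _ gAZ) => t Ct; apply/asboolP.
  by split=> x tx; exists (exist _ t Ct).
- have AT i : A i.
    have [C [Ci cC stC]] := stable_closure i; have stAC := stC A stA.
    have [Z' ZZ' bZ'] := basis_extend stA stAC cC bZ.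
    have gAC : good (A `|` C, Z') by [].
    have /asboolP[/= ACA _] : le (exist _ _ gAC) (exist _ (A, Z) (conj stA bZ)).
      by apply: tmax; apply/asboolP; split=> //= j; left.
    by apply: ACA; right.
  exists Z; suff -> : fix_set e = supp A `&` fix_set e by [].
  by rewrite eqEsubset; split=> v; [move=> ev; split | case].
Qed.

End Kaplansky.

(** * Passage between internal direct sums, coordinates and bases *)

Lemma fsum_seq (V : zmodType) (T : choiceType) (s : seq T) (g : T -> V) : uniq s ->
  (forall i, g i <> 0 -> i \in s) -> \sum_(i \in [set: T]) g i = \sum_(i <- s) g i.
Proof.
move=> us gs; rewrite (fsbigE s) //=.
  by apply: eq_bigl => i; rewrite in_setT.
by move=> i _ si; apply: contrapT => /gs; apply/negP.
Qed.

Lemma finite_support_seq (V : zmodType) (T : choiceType) (g : T -> V) :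
  finite_set [set i | g i <> 0] -> exists2 s : seq T, uniq s & forall i, g i <> 0 -> i \in s.
Proof.
move=> /finite_seqP[s sE]; exists (undup s); first exact: undup_uniq.
by move=> i gi; rewrite mem_undup; have : [set i | g i <> 0] i by []; rewrite sE.
Qed.

Section Decompositions.
Variables (R : idomainType) (M : lmodType R).

Section RankOne.
Variables (I : choiceType) (J : I -> set (quotfield R)) (phi : M -> I -> quotfield R).
Hypothesis crd : coordinates J phi.

Lemma pure_submodule (K : set M) : pure K -> submodule K.
Proof. by case=> K0 KD _; apply/submoduleE. Qed.

Lemma torsion_free_coordinates (K : set M) : torsion_free K.
Proof. by move=> r x _; apply: coord_torsion_free crd r x. Qed.

(** Any coordinate nonzero at [z] is injective on [hull z] and embeds it in [Q]. *)
Lemma rank_one_hull (z : M) : z <> 0 -> rank_one (hull z).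
Proof.
move=> z0; have hz := hull_pure z; split; first exact: pure_submodule.
  exact: torsion_free_coordinates.
have [i zi] : exists i, phi z i != 0.
  apply: contrapT => none; apply: z0; apply: (coord_inj crd) => i.
  rewrite (coords0 crd); apply/eqP; apply: contraT => zi.
  by case: none; exists i.
have hinj w : hull z w -> phi w i = 0 -> w = 0.
  move=> [r [s [r0 rw]]] wi; have : s *: phi z i = 0.
    by rewrite -(coordsZ crd) -rw (coordsZ crd) wi scaler0.
  move/eqP; rewrite scale_quot_eq0 (negPf zi) orbF => /eqP s0.
  by apply: (scaler_regular (coord_torsion_free crd) r0); rewrite rw s0 scale0r scaler0.
exists [set phi w i | w in hull z]; split.
- have [h0 hD _] := hz; apply/submoduleE; split; first by exists 0; rewrite ?(coords0 crd).
  move=> r _ _ [u hu <-] [v hv <-]; exists (r *: u + v); first exact: hD.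
  by rewrite (coord_linear crd).
- move=> /seteqP[sub _]; have := sub (phi z i); rewrite /= => zi0.
  by move: zi; rewrite zi0 ?eqxx //; exists z => //; apply: hull_id.
- exists (phi^~ i); split; first by move=> r x y _ _; rewrite (coord_linear crd).
  split=> [w hw|u v /set_mem hu /set_mem hv uv|_ [w hw <-]]; [by exists w | | by exists w].
  apply/eqP; rewrite -subr_eq0; apply/eqP/hinj; first exact: pureB.
  by rewrite (coordsB crd) uv subrr.
Qed.

Lemma basis_completely_decomposable (K Z : set M) : pure K -> basis K Z ->
  completely_decomposable K.
Proof.
move=> pK [ZK Zi Zs]; split; first exact: pure_submodule.
  exact: torsion_free_coordinates.
have Zval (i : Z) : Z (val i) by apply: set_mem; apply: valP.
exists Z, (fun i : Z => hull (val i)); split; first by move=> i; apply: rank_one_hull; case: (ZK _ (Zval i)).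
split=> [i|x /Zs]; first by apply: hull_sub => //; case: (ZK _ (Zval i)).
move=> Zx; have [g [gh [s us gs] xE]] : exists g : Z -> M, [/\ forall i, hull (val i) (g i),
    exists2 s : seq Z, uniq s & forall i, g i <> 0 -> i \in s
    & x = \sum_(i \in [set: Z]) g i].
  elim: Zx => [|z w v Zz zw _ [g [gh [s us gs] vE]]].
    exists (fun=> 0); split; [by move=> i; case: (hull_pure (val i)) | by exists [::] |].
    by rewrite (fsum_seq (s := [::])) // big_nil.
  (* The new summand [w] is added at index [k], which may already carry a nonzero term. *)
  pose k : Z := SigSub (mem_set Zz).
  exists (fun i => (if i == k then w else 0) + g i).
  pose t := undup (k :: s); have kt : k \in t by rewrite mem_undup mem_head.
  have ut : uniq t by apply: undup_uniq.
  have gt i : g i <> 0 -> i \in t by move/gs => si; rewrite mem_undup inE si orbT.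
  have wgt i : (if i == k then w else 0) + g i <> 0 -> i \in t.
    by case: (i =P k) => [->//|_]; rewrite add0r; apply: gt.
  split; first by move=> i; case: (i =P k) => [->|_]; rewrite ?add0r //; apply: pureD (hull_pure _) _ (gh k).
    by exists t.
  rewrite (fsum_seq ut wgt) vE (fsum_seq ut gt) big_split /=; congr (_ + _).
  by rewrite (bigD1_seq k) //= eqxx big1 ?addr0 // => i /negPf->.
exists g; split.
  by split=> //; apply: sub_finite_set (finite_seq s) => i /gs.
move=> g' [g'h /finite_support_seq[s' us' gs'] xE'].
pose t := undup (s ++ s'); have ut : uniq t by apply: undup_uniq.
have gt i : g i <> 0 -> i \in t by move/gs => si; rewrite mem_undup mem_cat si.
have g't i : g' i <> 0 -> i \in t by move/gs' => si; rewrite mem_undup mem_cat si orbT.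
have sum0 : \sum_(i <- t) (g i - g' i) = 0.
  by rewrite sumrB -(fsum_seq ut gt) -(fsum_seq ut g't) -xE -xE' subrr.
apply: funext => i; have [ti|/negP nti] := boolP (i \in t); last first.
  have -> : g i = 0 by apply: contrapT => /gt.
  by apply/esym; apply: contrapT => /g't.
have ghh j : hull (val j) (g j - g' j) by apply: pureB (hull_pure _) _ _.
(* The difference of two representations has its [i]-th term in one hull and, being minus the sum of
   the others, in the sum of the other hulls; independence makes it 0. *)
apply/eqP; rewrite -subr_eq0; apply/eqP; apply: (Zi (val i)) => //.
move: sum0; rewrite (bigD1_seq i) //= => /eqP; rewrite addr_eq0 => /eqP->.
rewrite -sumrN; apply: (big_ind (hull_sum (Z `\ val i))) => [|u v|j ji].
- exact: HullSum0.
- exact: hull_sum_add.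
- apply: (hull_sum_hull (z := val j)).
    by split=> // /val_inj ij; rewrite ij eqxx in ji.
  by rewrite opprB; apply: pureB (hull_pure _) _ _.
Qed.

End RankOne.

(** The components of a vector are sent into [Q] by the isomorphisms from [L i] to [J i]; uniqueness
    of the decomposition yields linearity and surjectivity. *)
Lemma coordinates_exist : completely_decomposable [set: M] ->
  exists (I : choiceType) (J : I -> set (quotfield R)) phi, coordinates (M := M) J phi.
Proof.
move=> [_ tf [I [L [L1 [_ dec]]]]]; exists I.
have /boolp.choice[comp compP] : forall x, exists g : I -> M,
    [/\ forall i, L i (g i), finite_set [set i | g i <> 0], x = \sum_(i \in [set: I]) g i
      & forall h : I -> M, (forall i, L i (h i)) -> finite_set [set i | h i <> 0] ->
          x = \sum_(i \in [set: I]) h i -> g = h].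
  move=> x; have [//|g [[gL gf xE] guniq]] := dec x.
  by exists g; split=> // h hL hf hE; apply: guniq.
have /boolp.choice[J JP] : forall i, exists J : set (quotfield R),
    [/\ submodule J, J <> [set 0] & submodule_iso (L i) J].
  by move=> i; have [_ _] := L1 i.
have /boolp.choice[f fP] : forall i, exists f : M -> quotfield R,
    (forall r x y, L i x -> L i y -> f (r *: x + y) = r *: f x + f y) /\ set_bij (L i) (J i) f.
  by move=> i; have [_ _] := JP i.
have subL i : L i 0 /\ forall r u v, L i u -> L i v -> L i (r *: u + v).
  by apply/submoduleE; case: (L1 i).
have f0 i : f i 0 = 0.
  have [flin _] := fP i; have [L0 _] := subL i.
  by have := flin (-1) 0 0 L0 L0; rewrite scaler0 addr0 scaleN1r addNr.
have finj i x y : L i x -> L i y -> f i x = f i y -> x = y.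
  by move=> Lx Ly; have [_ [_ inj _]] := fP i; apply: inj; apply: mem_set.
have compL x i : L i (comp x i) by case: (compP x).
have compf x : finite_set [set i | comp x i <> 0] by case: (compP x).
have compE x : x = \sum_(i \in [set: I]) comp x i by case: (compP x).
have compU x h : (forall i, L i (h i)) -> finite_set [set i | h i <> 0] ->
    x = \sum_(i \in [set: I]) h i -> comp x = h.
  by move=> hL hf hE; have [_ _ _ uniq] := compP x; apply: uniq.
exists J, (fun x i => f i (comp x i)); split.
- by move=> i; case: (JP i).
- move=> i; have [subJ J0 _] := JP i; apply: contrapT => none; apply: J0.
  have [J0 _] := (submoduleE _).1 subJ.
  rewrite eqEsubset; split=> [q Jq /=|q ->//]; apply: contrapT => /eqP q0.
  by apply: none; exists q.
- move=> r u v i; have [flin _] := fP i; rewrite -flin //; congr (f i _).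
  suff -> : comp (r *: u + v) = fun j => r *: comp u j + comp v j by [].
  have [s us su] := finite_support_seq (compf u).
  have [s' us' sv] := finite_support_seq (compf v).
  pose t := undup (s ++ s'); have ut : uniq t by apply: undup_uniq.
  have tu j : comp u j <> 0 -> j \in t by move/su => sj; rewrite mem_undup mem_cat sj.
  have tv j : comp v j <> 0 -> j \in t by move/sv => sj; rewrite mem_undup mem_cat sj orbT.
  have tuv j : r *: comp u j + comp v j <> 0 -> j \in t.
    apply: contra_notT => tj; have -> : comp u j = 0.
      by apply: contrapT => /tu; apply/negP.
    have -> : comp v j = 0 by apply: contrapT => /tv; apply/negP.
    by rewrite scaler0 addr0.
  apply: compU.
  + by move=> j; have [_ LD] := subL j; apply: LD.
  + by apply: sub_finite_set (finite_seq t) => j /tuv.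
  + rewrite (fsum_seq ut tuv) big_split /= -scaler_sumr.
    by rewrite -(fsum_seq ut tu) -(fsum_seq ut tv) -!compE.
- by move=> u i; have [_ [fun_f _ _]] := fP i; apply: fun_f.
- move=> u v uv; have cuv : comp u = comp v by apply: funext => i; apply: (finj i).
  by rewrite (compE u) cuv -compE.
- move=> u; have [s us su] := finite_support_seq (compf u); exists s => i.
  by move=> fi; apply: su => ui; rewrite ui f0 eqxx in fi.
- move=> h s hs hJ.
  have /boolp.choice[k kP] : forall i, exists x, L i x /\ f i x = h i.
    by move=> i; have [_ [_ _ surj]] := fP i; have [x Lx xh] := surj _ (hJ i); exists x.
  have ks i : k i <> 0 -> i \in s.
    move=> ki; apply: hs; apply/eqP => hi; apply: ki; have [Lk fk] := kP i.
    by apply: (finj i) => //; [case: (subL i) | rewrite fk hi f0].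
  exists (\sum_(i \in [set: I]) k i) => i; rewrite (@compU _ k) //.
  + by case: (kP i).
  + by move=> j; case: (kP j).
  + by apply: sub_finite_set (finite_seq s) => j /ks.
Qed.

(** [e] is the projection onto [N] along the complement [B]; it is linear because the component in
    [N] is unique. *)
Lemma direct_summand_idempotent (N : set M) : direct_summand N ->
  exists e : M -> M, [/\ linear e, forall v, e (e v) = e v & N = fix_set e].
Proof.
move=> [subN [B [subB NB dec]]].
have /boolp.choice[e eP] : forall x, exists a, N a /\ B (x - a).
  by move=> x; have [a [b [Na Bb ->]]] := dec x; exists a; rewrite addrC addKr.
have [N0 ND] := (submoduleE _).1 subN; have [B0 BD] := (submoduleE _).1 subB.
have uniq x a : N a -> B (x - a) -> e x = a.
  move=> Na Bxa; have [Ne Be] := eP x; apply/eqP; rewrite -subr_eq0.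
  have : (N `&` B) (e x - a).
    split; first by rewrite addrC -scaleN1r; apply: ND.
    have -> : e x - a = (-1) *: (x - e x) + (x - a).
      by rewrite scaleN1r opprB addrA subrK.
    exact: BD.
  by rewrite NB => ->.
have eN x : N x -> e x = x by move=> Nx; apply: uniq => //; rewrite subrr.
exists e; split.
- move=> r u v; have [Nu Bu] := eP u; have [Nv Bv] := eP v; apply: uniq; first exact: ND.
  have -> : r *: u + v - (r *: e u + e v) = r *: (u - e u) + (v - e v).
    by rewrite scalerBr opprD addrACA.
  exact: BD.
- by move=> v; apply: eN; case: (eP v).
- rewrite eqEsubset; split=> v; first exact: eN.
  by rewrite /fix_set /= => <-; case: (eP v).
Qed.

End Decompositions.

Theorem theorem3p2 (R : idomainType) (M : lmodType R) (N : set M) :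
  h_local R -> prufer R ->
  completely_decomposable [set: M]%classic ->
  direct_summand N ->
  completely_decomposable N.
Proof.
move=> hl pr /coordinates_exist[I [J [phi crd]]] /direct_summand_idempotent[e [el ee ->]].
have [Z bZ] := summand_basis_exists crd hl pr el ee.
exact (basis_completely_decomposable crd (fix_set_pure crd el) bZ).
Qed.
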